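(* Let $U$ and $A$ be bialgebras over a field $k$, suppose $\tau: U\otimes A\to k$ is a convolution invertible linear form satisfying (A.1)–(A.4) (listed in the context), and let $H=(U\otimes A)^\sigma$. Suppose that all $\rho\in\mathrm{Alg}(U,k)$ and all $\chi\in\mathrm{Alg}(A,k)$ are determined by their respective restrictions $\rho|_{G(U)}$ and $\chi|_{G(A)}$. Then $\mathrm{Alg}(U,k)$ and $\mathrm{Alg}(A,k)$ are abelian groups and: a) The map $\mathrm{Alg}(U,k)\times\mathrm{Alg}(A,k)\to[{}_H\underline{\mathcal M}]$ given by $(\rho,\chi)\mapsto[L(\rho,\chi)]$ is bijective. b) Every object of ${}_H\underline{\mathcal M}$ has a unique one-dimensional $A$-submodule and a unique codimension one $U$-submodule. c) Suppose that the finite-dimensional irreducible left $U$-modules and the finite-dimensional irreducible left $A$-modules are one-dimensional. Then the finite-dimensional irreducible left $H$-modules are the finite-dimensional objects of ${}_H\underline{\mathcal M}$.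
   Context: $\mathrm{Alg}(X,k)$ is the set of unital algebra homomorphisms $X\to k$; for a bialgebra $X$ it is considered with the convolution product of the dual algebra $X^*$. $G(X)$ is the set of grouplike elements of $X$. Sweedler notation $\Delta(x)=x_{(1)}\otimes x_{(2)}$ is used, and $\tau(u,a)=\tau(u\otimes a)$. Axioms: (A.1) $\tau(u,aa')=\tau(u_{(2)},a)\tau(u_{(1)},a')$; (A.2) $\tau(1,a)=\epsilon(a)$; (A.3) $\tau(uu',a)=\tau(u,a_{(1)})\tau(u',a_{(2)})$; (A.4) $\tau(u,1)=\epsilon(u)$; for all $u,u'\in U$, $a,a'\in A$. Convolution invertible means invertible in the dual algebra $(U\otimes A)^*$ of the tensor product coalgebra; $\tau^{-1}$ is the inverse. $H=(U\otimes A)^\sigma$ is the bialgebra which is $U\otimes A$ as a coalgebra, with unit $1\otimes1$ and multiplication $$(u\otimes a)(u'\otimes a')=\tau(u'_{(1)},a_{(1)})\,uu'_{(2)}\otimes a_{(2)}a'\,\tau^{-1}(u'_{(3)},a_{(3)}).$$ $U$ and $A$ are subalgebras of $H$ via $u\mapsto u\otimes1$, $a\mapsto1\otimes a$. For $\chi\in\mathrm{Alg}(A,k)$, $U_\chi$ is the left $H$-module with underlying space $U$ and action $(u\otimes a)\cdot_\chi u'=u\big((\mathrm{id}_U\otimes\chi)((1\otimes a)(u'\otimes1))\big)$. For $\rho\in\mathrm{Alg}(U,k)$, $I(\rho,\chi)$ is the sum of all left $H$-submodules of $U_\chi$ contained in $\mathrm{Ker}\,\rho$, and $L(\rho,\chi)=U_\chi/I(\rho,\chi)$.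 ${}_H\underline{\mathcal M}$ is the category whose objects are the left $H$-modules $M$ which are generated (as $H$-modules) by some one-dimensional left $A$-submodule $km$ and which have some codimension one left $U$-submodule $N$ such that $(0)$ is the only left $H$-submodule of $M$ contained in $N$; morphisms are left $H$-module maps. $[{}_H\underline{\mathcal M}]$ denotes the isomorphism classes of its objects, and $[M]$ the isomorphism class of $M$.
   Formalization: ''Alg(U,k) and Alg(A,k) are abelian groups'' fails for general bialgebras (U=k[x], x grouplike, A=k gives the monoid (k,·)); it is proved that they are commutative monoids, and abelian groups when U, respectively A, has an antipode. *)

(* Defs.v *)
From HB Require Import structures.
From mathcomp Require Import all_boot all_algebra.
From mathcomp Require Import boolp classical_sets.

Set Implicit Arguments.
Unset Strict Implicit.
Unset Printing Implicit Defensive.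

Import GRing.Theory.
Local Open Scope ring_scope.
Local Open Scope quotient_scope.

Reserved Notation "u \ox v" (at level 40, left associativity).

(** The tensor product of two vector spaces: formal finite sums of pairs, modulo the congruence generated by the
    bilinearity relations.  Scalars act on the left component. *)

Section Tensor.
Variables (k : fieldType) (U V : lmodType k).

Inductive tens_rel : seq (U * V) -> seq (U * V) -> Prop :=
| tens_refl s : tens_rel s s
| tens_sym s t : tens_rel s t -> tens_rel t s
| tens_trans s t r : tens_rel s t -> tens_rel t r -> tens_rel s r
| tens_cat s s' t t' : tens_rel s s' -> tens_rel t t' ->
    tens_rel (s ++ t) (s' ++ t')
| tens_catC s t : tens_rel (s ++ t) (t ++ s)
| tens_zero v : tens_rel [:: (0, v)] [::]
| tens_addl u u' v : tens_rel [:: (u + u', v)] [:: (u, v); (u', v)]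
| tens_addr u v v' : tens_rel [:: (u, v + v')] [:: (u, v); (u, v')]
| tens_scale c u v : tens_rel [:: (c *: u, v)] [:: (u, c *: v)].

Definition tens_eq (s t : seq (U * V)) : bool := `[< tens_rel s t >].

Lemma tens_eq_equiv : equiv_class_of tens_eq.
Proof.
split=> [s|s t|t s r].
- exact/asboolP/tens_refl.
- by apply/asboolP/asboolP; apply: tens_sym.
- move=> /asboolP st /asboolP tr; apply/asboolP; exact: tens_trans st tr.
Qed.

Canonical tens_eq_equivrel := EquivRelPack tens_eq_equiv.
Canonical tens_eq_encModRel := defaultEncModRel tens_eq.

Definition tensor := {eq_quot tens_eq}.
HB.instance Definition _ : EqQuotient _ tens_eq tensor := EqQuotient.on tensor.
HB.instance Definition _ := Choice.on tensor.

Definition tpi (s : seq (U * V)) : tensor := \pi_tensor s.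

Lemma tpiP s t : tpi s = tpi t <-> tens_rel s t.
Proof.
split; last by move=> st; apply/eqmodP/asboolP.
by move/eqmodP/asboolP.
Qed.

(** A tensor [t] is [\sum_(p <- trep t) p.1 \ox p.2] (see [trepE]). *)
Definition trep (t : tensor) : seq (U * V) := repr t.

Lemma tpiK t : tpi (trep t) = t. Proof. exact: reprK. Qed.

Lemma trepK s : tens_rel (trep (tpi s)) s.
Proof. by apply/tpiP; rewrite tpiK. Qed.

Definition tadd (t t' : tensor) := tpi (trep t ++ trep t').
Definition tscale (c : k) (t : tensor) :=
  tpi [seq (c *: p.1, p.2) | p <- trep t].

Lemma tadd_pi s t : tadd (tpi s) (tpi t) = tpi (s ++ t).
Proof. by apply/tpiP/tens_cat; apply: trepK. Qed.

Lemma tens_rel_scale c s t : tens_rel s t ->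
  tens_rel [seq (c *: p.1, p.2) | p <- s] [seq (c *: p.1, p.2) | p <- t].
Proof.
elim=> {s t} [s|s t _|s t r _ IH1 _ IH2|s s' t t' _ IH1 _ IH2|s t|v|u u' v|u v v'|d u v] /=.
- exact: tens_refl.
- exact: tens_sym.
- exact: tens_trans IH1 IH2.
- by rewrite !map_cat; apply: tens_cat.
- by rewrite !map_cat; apply: tens_catC.
- by rewrite scaler0; apply: tens_zero.
- by rewrite scalerDr; apply: tens_addl.
- exact: tens_addr.
- by rewrite scalerA mulrC -scalerA; apply: tens_scale.
Qed.

Lemma tscale_pi c s : tscale c (tpi s) = tpi [seq (c *: p.1, p.2) | p <- s].
Proof. by apply/tpiP/tens_rel_scale/trepK. Qed.

Lemma taddA : associative tadd.
Proof. by move=> x y z; rewrite -(tpiK x) -(tpiK y) -(tpiK z) !tadd_pi catA. Qed.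
Lemma taddC : commutative tadd.
Proof.
move=> x y; rewrite -(tpiK x) -(tpiK y) !tadd_pi; exact/tpiP/tens_catC.
Qed.
Lemma tadd0 : left_id (tpi [::]) tadd.
Proof. by move=> x; rewrite -(tpiK x) tadd_pi. Qed.

Lemma tscaleDl x a b : tscale (a + b) x = tadd (tscale a x) (tscale b x).
Proof.
rewrite -(tpiK x) !tscale_pi tadd_pi; apply/tpiP; elim: (trep x) => [|p s IH] /=.
  exact: tens_refl.
rewrite scalerDl -[_ :: map _ s]/([:: (a *: p.1 + b *: p.1, p.2)] ++ _).
apply: tens_trans (tens_cat (tens_addl _ _ _) IH) _.
rewrite -!cat_cons -cat1s /= -[in X in tens_rel _ X]cat1s.
rewrite -[X in tens_rel X _]/([:: (a *: p.1, p.2)] ++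
  (([:: (b *: p.1, p.2)] ++ [seq (a *: q.1, q.2) | q <- s])
   ++ [seq (b *: q.1, q.2) | q <- s])).
rewrite -[X in tens_rel _ X]/([:: (a *: p.1, p.2)] ++
  ([seq (a *: q.1, q.2) | q <- s]
   ++ ([:: (b *: p.1, p.2)] ++ [seq (b *: q.1, q.2) | q <- s]))).
apply: tens_cat; first exact: tens_refl.
by rewrite [X in tens_rel _ X]catA; apply: tens_cat (tens_catC _ _) (tens_refl _).
Qed.

Lemma tscale0 x : tscale 0 x = tpi [::].
Proof.
rewrite -(tpiK x) tscale_pi; apply/tpiP; elim: (trep x) => [|p s IH] /=.
  exact: tens_refl.
by rewrite scale0r; apply: tens_cat (tens_zero _) IH.
Qed.
Lemma tscale1 : left_id 1 tscale.
Proof.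
move=> x; rewrite -[RHS](tpiK x) -{1}(tpiK x) tscale_pi.
by congr tpi; apply: map_id_in => -[u v] _; rewrite scale1r.
Qed.
Lemma tscaleA a b x : tscale a (tscale b x) = tscale (a * b) x.
Proof.
rewrite -(tpiK x) !tscale_pi -map_comp; congr tpi.
by apply: eq_map => p /=; rewrite scalerA.
Qed.
Lemma tscaleDr : right_distributive tscale tadd.
Proof.
by move=> a x y; rewrite -(tpiK x) -(tpiK y) tadd_pi !tscale_pi map_cat tadd_pi.
Qed.
Lemma taddN : left_inverse (tpi [::]) (tscale (-1)) tadd.
Proof. by move=> x; rewrite -{2}(tscale1 x) -tscaleDl addNr tscale0. Qed.

HB.instance Definition _ := GRing.isZmodule.Build tensor taddA taddC tadd0 taddN.
HB.instance Definition _ :=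
  GRing.Zmodule_isLmodule.Build k tensor tscaleA tscale1 tscaleDr
    (fun x a b => tscaleDl x a b).

Definition tens (u : U) (v : V) : tensor := tpi [:: (u, v)].
Local Notation "u \ox v" := (tens u v).

Lemma tpiE s : tpi s = \sum_(p <- s) p.1 \ox p.2.
Proof.
elim: s => [|p s IH]; first by rewrite big_nil.
by rewrite big_cons -IH -[LHS](tadd_pi [:: p]) /tens -surjective_pairing.
Qed.

Lemma trepE t : t = \sum_(p <- trep t) p.1 \ox p.2.
Proof. by rewrite -tpiE tpiK. Qed.

Lemma tensDl u u' v : (u + u') \ox v = u \ox v + u' \ox v.
Proof. by rewrite -[RHS]/(tadd _ _) tadd_pi; apply/tpiP; apply: tens_addl. Qed.
Lemma tensDr u v v' : u \ox (v + v') = u \ox v + u \ox v'.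
Proof. by rewrite -[RHS]/(tadd _ _) tadd_pi; apply/tpiP; apply: tens_addr. Qed.
Lemma tensZl c u v : (c *: u) \ox v = c *: (u \ox v).
Proof. by rewrite -[RHS]/(tscale _ _) tscale_pi. Qed.
Lemma tensZr c u v : u \ox (c *: v) = c *: (u \ox v).
Proof. by rewrite -tensZl; apply/tpiP/tens_sym/tens_scale. Qed.

Lemma tensor_ind (P : tensor -> Prop) :
  P 0 -> (forall t t', P t -> P t' -> P (t + t')) ->
  (forall u v, P (u \ox v)) -> forall t, P t.
Proof.
move=> P0 PD Pt t; rewrite (trepE t).
by elim: (trep t) => [|p s IH]; rewrite ?big_nil // big_cons; apply: PD.
Qed.

Definition bilin (W : lmodType k) (f : U -> V -> W) :=
  (forall v, linear (f^~ v)) /\ (forall u, linear (f u)).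

(** The linear map induced by [f], for bilinear [f] (see [tlift_tens] and
    [tlift_linear]); [tlift (fun x y => E) (Delta c)] renders an expression
    [E] in Sweedler notation, with [x = c_(1)] and [y = c_(2)]. *)
Definition tlift (W : lmodType k) (f : U -> V -> W) (t : tensor) : W :=
  \sum_(p <- trep t) f p.1 p.2.

Section Lift.
Variables (W : lmodType k) (f : U -> V -> W).
Hypothesis bf : bilin f.

Let f0l v : f 0 v = 0.
Proof.
by have /(_ (-1) 0 0) := bf.1 v; rewrite /= scaler0 addr0 scaleN1r addNr.
Qed.
Let f0r u : f u 0 = 0.
Proof.
by have /(_ (-1) 0 0) := bf.2 u; rewrite /= scaler0 addr0 scaleN1r addNr.
Qed.

Lemma tens_rel_lift s t : tens_rel s t ->
  \sum_(p <- s) f p.1 p.2 = \sum_(p <- t) f p.1 p.2.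
Proof.
elim=> {s t} [s|s t _|s t r _ IH1 _ IH2|s s' t t' _ IH1 _ IH2|s t|v|u u' v|u v v'|d u v] //=.
- exact: etrans IH1 IH2.
- by rewrite !big_cat /= IH1 IH2.
- by rewrite !big_cat /= addrC.
- by rewrite big_seq1 big_nil f0l.
- rewrite !big_cons !big_nil /= !addr0.
  by have /(_ 1 u u') := bf.1 v; rewrite /= !scale1r.
- rewrite !big_cons !big_nil /= !addr0.
  by have /(_ 1 v v') := bf.2 u; rewrite /= !scale1r.
- rewrite !big_seq1 /=.
  have /(_ d u 0) := bf.1 v; rewrite /= !addr0 f0l addr0 => ->.
  by have /(_ d v 0) := bf.2 u; rewrite !addr0 f0r addr0 => ->.
Qed.

Lemma tlift_pi s : tlift f (tpi s) = \sum_(p <- s) f p.1 p.2.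
Proof. exact/tens_rel_lift/trepK. Qed.

Lemma tlift_tens u v : tlift f (u \ox v) = f u v.
Proof. by rewrite tlift_pi big_seq1. Qed.

Lemma tlift_linear : linear (tlift f).
Proof.
move=> a x y; rewrite -(tpiK x) -(tpiK y).
rewrite -[a *: _]/(tscale _ _) tscale_pi -[_ + tpi _]/(tadd _ _) tadd_pi.
rewrite !tlift_pi big_cat big_map scaler_sumr; congr (_ + _).
apply: eq_bigr => p _ /=.
by have /(_ a p.1 0) := bf.1 p.2; rewrite /= !addr0 f0l addr0.
Qed.
End Lift.

Lemma tensor_linear_ext (W : lmodType k) (f g : {linear tensor -> W}) :
  (forall u v, f (u \ox v) = g (u \ox v)) -> f =1 g.
Proof.
move=> fg; elim/tensor_ind => [|t t' IH IH'|//]; first by rewrite !linear0.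
by rewrite !linearD IH IH'.
Qed.

End Tensor.

Notation "u \ox v" := (tens u v) : ring_scope.

Section TliftTheory.
Variables (k : fieldType) (U V W W' : lmodType k).
Implicit Types (f g : U -> V -> W) (t : tensor U V).

Lemma eq_tlift f g t : (forall u v, f u v = g u v) -> tlift f t = tlift g t.
Proof. by move=> fg; apply: eq_bigr. Qed.

Lemma tlift_comp (h : W -> W') f t : linear h ->
  h (tlift f t) = tlift (fun u v => h (f u v)) t.
Proof.
move=> lh; have h0 : h 0 = 0.
  by have /(_ (-1) 0 0) := lh; rewrite !scaler0 addr0 scaleN1r addNr.
have hD x y : h (x + y) = h x + h y by have /(_ 1 x y) := lh; rewrite !scale1r.
by rewrite /tlift; apply: (big_morph h hD h0).
Qed.

Lemma tliftP a f g t :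
  tlift (fun u v => a *: f u v + g u v) t = a *: tlift f t + tlift g t.
Proof. by rewrite /tlift big_split -scaler_sumr. Qed.

Lemma tens_linl (v : V) : linear ((@tens k U V)^~ v).
Proof. by move=> a u u' /=; rewrite tensDl tensZl. Qed.
Lemma tens_linr (u : U) : linear (@tens k U V u).
Proof. by move=> a v v'; rewrite tensDr tensZr. Qed.

Lemma bilin_tens : bilin (@tens k U V).
Proof. by split=> *; [apply: tens_linl | apply: tens_linr]. Qed.

Lemma bilin_comp (h : W -> W') f : linear h -> bilin f ->
  bilin (fun u v => h (f u v)).
Proof.
by move=> lh [f1 f2]; split=> u a x y /=; rewrite ?f2 -?lh //; congr h; apply: f1.
Qed.

Lemma linear_tlift (Z : lmodType k) (h : Z -> U -> V -> W) t :
  (forall u v, linear (fun z => h z u v)) -> linear (fun z => tlift (h z) t).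
Proof.
by move=> lh a x y /=; rewrite -tliftP; apply: eq_tlift => u v; apply: lh.
Qed.

Lemma tensor_linear_eq (f g : tensor U V -> W) : linear f -> linear g ->
  (forall u v, f (u \ox v) = g (u \ox v)) -> f =1 g.
Proof.
move=> lf lg fg t; rewrite (trepE t).
rewrite -[\sum_(p <- _) _]/(tlift (@tens _ _ _) t).
transitivity (tlift (fun u v => f (u \ox v)) t).
  by rewrite /tlift; apply: (big_morph f) => [x y|];
     [have /(_ 1 x y) := lf; rewrite !scale1r
     |have /(_ (-1) 0 0) := lf; rewrite !scaler0 addr0 scaleN1r addNr].
transitivity (tlift (fun u v => g (u \ox v)) t); first exact: eq_tlift.
symmetry; rewrite /tlift; apply: (big_morph g) => [x y|];
     [by have /(_ 1 x y) := lg; rewrite !scale1r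
     |by have /(_ (-1) 0 0) := lg; rewrite !scaler0 addr0 scaleN1r addNr].
Qed.

End TliftTheory.

Arguments tlift_comp {k U V W W' h f} t _.

Lemma linear_compl (k : fieldType) (X Y Z : lmodType k) (f : Y -> Z) (g : X -> Y) :
  linear f -> linear g -> linear (fun x => f (g x)).
Proof. by move=> lf lg a x y; rewrite lg lf. Qed.

Section TensorRing.
Variables (k : fieldType) (U V : algType k).
Local Notation T := (tensor U V).

Definition tmul (x y : T) : T :=
  tlift (fun u v => tlift (fun u' v' => (u * u') \ox (v * v')) y) x.

Let bil u v : bilin (fun u' v' => (u * u') \ox (v * v') : T).
Proof.
split=> w a x y /=.
  by rewrite mulrDr -scalerAr tens_linl.
by rewrite mulrDr -scalerAr tens_linr.
Qed.

Let bil2 y : bilin (fun u v => tlift (fun u' v' => (u * u') \ox (v * v') : T) y).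
Proof.
split=> w; apply: linear_tlift => u' v' a x x' /=.
  by rewrite mulrDl -scalerAl tens_linl.
by rewrite mulrDl -scalerAl tens_linr.
Qed.

Lemma tmul_tens u v u' v' :
  tmul (u \ox v) (u' \ox v') = (u * u') \ox (v * v').
Proof. by rewrite /tmul tlift_tens // tlift_tens. Qed.

Lemma tmul_linl y : linear (tmul^~ y).
Proof. exact: tlift_linear (bil2 y). Qed.
Lemma tmul_linr x : linear (tmul x).
Proof. by apply: linear_tlift => u v; apply: tlift_linear. Qed.

Lemma tmulA : associative tmul.
Proof.
move=> x y z.
apply: (tensor_linear_eq (f := fun x => tmul x (tmul y z))
  (g := fun x => tmul (tmul x y) z)); [exact: tmul_linl | | move=> u v {x}].
  by apply: (linear_compl (f := tmul^~ z) (g := tmul^~ y)); apply: tmul_linl.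
apply: (tensor_linear_eq (f := fun y => tmul _ (tmul y z))
  (g := fun y => tmul (tmul _ y) z)); [| | move=> u' v' {y}].
- by apply: (linear_compl (g := tmul^~ z)); [apply: tmul_linr | apply: tmul_linl].
- by apply: (linear_compl (f := tmul^~ z)); [apply: tmul_linl | apply: tmul_linr].
apply: (tensor_linear_eq (f := fun z => tmul _ (tmul _ z))); [| |move=> u2 v2 {z}].
- by apply: linear_compl; apply: tmul_linr.
- exact: tmul_linr.
by rewrite !tmul_tens !mulrA.
Qed.

Lemma tmul1l : left_id (1 \ox 1) tmul.
Proof.
move=> x; apply: (tensor_linear_eq (g := id)) => // [|u v].
  exact: tmul_linr.
by rewrite tmul_tens !mul1r.
Qed.
Lemma tmul1r : right_id (1 \ox 1) tmul.
Proof.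
move=> x; apply: (tensor_linear_eq (f := tmul^~ _) (g := id)) => // [|u v].
  exact: tmul_linl.
by rewrite tmul_tens !mulr1.
Qed.
Lemma tmulDl : left_distributive tmul +%R.
Proof. by move=> x y z; have /(_ 1 x y) := tmul_linl z; rewrite /= !scale1r. Qed.
Lemma tmulDr : right_distributive tmul +%R.
Proof. by move=> x y z; have /(_ 1 y z) := tmul_linr x; rewrite /= !scale1r. Qed.

HB.instance Definition _ :=
  GRing.Zmodule_isPzRing.Build T tmulA tmul1l tmul1r tmulDl tmulDr.

Lemma tensM u v u' v' : (u \ox v) * (u' \ox v') = (u * u') \ox (v * v') :> T.
Proof. exact: tmul_tens. Qed.

End TensorRing.

(** Both sides of [comulA] live in [C (x) (C (x) C)]. *)
HB.mixin Record isCoalgebra (k : fieldType) C of GRing.Lmodule k C := {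
  comul : {linear C -> tensor C C};
  counit : {scalar C};
  comulA : forall c : C,
    tlift (fun x y => tlift (fun x1 x2 => x1 \ox (x2 \ox y)) (comul x)) (comul c)
    = tlift (fun x y => x \ox comul y) (comul c);
  counit_comull : forall c : C, tlift (fun x y => counit x *: y) (comul c) = c;
  counit_comulr : forall c : C, tlift (fun x y => counit y *: x) (comul c) = c
}.

#[short(type="coalgType")]
HB.structure Definition Coalgebra (k : fieldType) :=
  {C of GRing.Lmodule k C & isCoalgebra k C}.

HB.mixin Record isBialgebra (k : fieldType) B
    of GRing.Algebra k B & Coalgebra k B := {
  comul_monoid_morphism : monoid_morphism (comul : B -> tensor B B);
  counit_monoid_morphism : monoid_morphism (counit : B -> k)
}.

#[short(type="bialgType")]
HB.structure Definition Bialgebra (k : fieldType) :=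
  {B of GRing.Algebra k B & Coalgebra k B & isBialgebra k B}.

Section Coalgebra.
Variables (k : fieldType) (C : coalgType k).

Definition grouplike (c : C) := comul c = c \ox c /\ counit c = 1.

(** The product of the dual algebra of [C]; its unit is [counit]. *)
Definition conv (f g : C -> k) (c : C) : k :=
  tlift (fun x y => f x * g y : k^o) (comul c).

Definition conv_inverse (f g : C -> k) :=
  (forall c, conv f g c = counit c) /\ (forall c, conv g f c = counit c).

(** [f c_(1) c_(2) c_(3)] *)
Definition sweedler3 (W : lmodType k) (f : C -> C -> C -> W) (c : C) : W :=
  tlift (fun x y => tlift (fun y1 y2 => f x y1 y2) (comul y)) (comul c).

End Coalgebra.

Section TensorCoalgebra.
Variables (k : fieldType) (U A : coalgType k).
Local Notation T := (tensor U A).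

Definition tensor_comul (t : T) : tensor T T :=
  tlift (fun u a =>
    tlift (fun u1 u2 =>
      tlift (fun a1 a2 => (u1 \ox a1) \ox (u2 \ox a2)) (comul a)) (comul u)) t.

Definition tensor_counit (t : T) : k :=
  tlift (fun (u : U) (a : A) => counit u * counit a : k^o) t.

Let bil_mid1 (u1 u2 : U) :
  bilin (fun a1 a2 => (u1 \ox a1) \ox (u2 \ox a2) : tensor T T).
Proof.
split=> a c x y /=; first by rewrite tens_linr tens_linl.
by rewrite tens_linr tens_linr.
Qed.

Let bil_mid2 (s : tensor A A) :
  bilin (fun u1 u2 => tlift (fun a1 a2 => (u1 \ox a1) \ox (u2 \ox a2) : tensor T T) s).
Proof.
split=> u; apply: linear_tlift => a1 a2 c x y /=.
  by rewrite !tens_linl.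
by rewrite tens_linl tens_linr.
Qed.

Let bil_comul : bilin (fun (u : U) (a : A) => tlift (fun u1 u2 =>
      tlift (fun a1 a2 => (u1 \ox a1) \ox (u2 \ox a2) : tensor T T) (comul a)) (comul u)).
Proof.
split=> u c x y.
  by rewrite linearP tlift_linear.
rewrite linearP -tliftP; apply: eq_tlift => u1 u2.
by rewrite tlift_linear.
Qed.

Lemma tensor_comul_tens u a : tensor_comul (u \ox a) =
  tlift (fun u1 u2 => tlift (fun a1 a2 => (u1 \ox a1) \ox (u2 \ox a2)) (comul a)) (comul u).
Proof. by rewrite /tensor_comul tlift_tens. Qed.

Lemma tensor_comul_linear : linear tensor_comul.
Proof. exact: tlift_linear. Qed.

Let bil_counit : bilin (fun (u : U) (a : A) => counit u * counit a : k^o).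
Proof.
split=> u c x y /=; rewrite linearP.
  by rewrite mulrDl -mulrA.
by rewrite mulrDr mulrCA.
Qed.

Lemma tensor_counit_tens u a : tensor_counit (u \ox a) = counit u * counit a.
Proof. by rewrite /tensor_counit tlift_tens. Qed.

Lemma tensor_counit_linear : scalar tensor_counit.
Proof. exact: (tlift_linear bil_counit). Qed.

HB.instance Definition _ :=
  GRing.isLinear.Build k T (tensor T T) _ tensor_comul tensor_comul_linear.
HB.instance Definition _ :=
  GRing.isLinear.Build k T k _ tensor_counit tensor_counit_linear.

Lemma tensor_counit_comull t :
  tlift (fun x y => tensor_counit x *: y) (tensor_comul t) = t.
Proof.
have b : bilin (fun (x y : T) => tensor_counit x *: y).
  split=> z c x y /=; first by rewrite linearP scalerDl scalerA.
  by rewrite scalerDr !scalerA mulrC.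
move: t; apply: (tensor_linear_eq (g := id)) => // [|u a].
  by apply: linear_compl; [apply: tlift_linear | apply: tensor_comul_linear].
rewrite tensor_comul_tens (tlift_comp _ (tlift_linear b)).
transitivity (tlift (fun u1 u2 => tlift (fun a1 a2 =>
    (counit u1 *: u2) \ox (counit a1 *: a2) : T) (comul a)) (comul u)).
  apply: eq_tlift => u1 u2; rewrite (tlift_comp _ (tlift_linear b)).
  apply: eq_tlift => a1 a2.
  by rewrite tlift_tens // tensor_counit_tens tensZl tensZr scalerA.
transitivity (tlift (fun u1 u2 => (counit u1 *: u2) \ox a : T) (comul u)).
  apply: eq_tlift => u1 u2.
  by rewrite -(tlift_comp _ (tens_linr _)) counit_comull.
by rewrite -(tlift_comp _ (tens_linl a)) counit_comull.
Qed.

Lemma tensor_counit_comulr t :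
  tlift (fun x y => tensor_counit y *: x) (tensor_comul t) = t.
Proof.
have b : bilin (fun (x y : T) => tensor_counit y *: x).
  split=> z c x y /=; last by rewrite linearP scalerDl scalerA.
  by rewrite scalerDr !scalerA mulrC.
move: t; apply: (tensor_linear_eq (g := id)) => // [|u a].
  by apply: linear_compl; [apply: tlift_linear | apply: tensor_comul_linear].
rewrite tensor_comul_tens (tlift_comp _ (tlift_linear b)).
transitivity (tlift (fun u1 u2 => tlift (fun a1 a2 =>
    (counit u2 *: u1) \ox (counit a2 *: a1) : T) (comul a)) (comul u)).
  apply: eq_tlift => u1 u2; rewrite (tlift_comp _ (tlift_linear b)).
  apply: eq_tlift => a1 a2.
  by rewrite tlift_tens // tensor_counit_tens tensZl tensZr scalerA.
transitivity (tlift (fun u1 u2 => (counit u2 *: u1) \ox a : T) (comul u)).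
  apply: eq_tlift => u1 u2.
  by rewrite -(tlift_comp _ (tens_linr _)) counit_comulr.
by rewrite -(tlift_comp _ (tens_linl a)) counit_comulr.
Qed.

Let TTT := tensor T (tensor T T).

Let phi4 (x y z : U) (a b c : A) : TTT := (x \ox a) \ox ((y \ox b) \ox (z \ox c)).

Let phi3 (x y z : U) (t : tensor A (tensor A A)) : TTT :=
  tlift (fun a bc => tlift (fun b c => phi4 x y z a b c) bc) t.

Let phi2 (t : tensor A (tensor A A)) (s : tensor U (tensor U U)) : TTT :=
  tlift (fun x yz => tlift (fun y z => phi3 x y z t) yz) s.

Let phi4_bil x y z a : bilin (phi4 x y z a).
Proof. by split=> w c p q; rewrite /phi4 /= ?tens_linr ?tens_linl ?tens_linr. Qed.

Let phi3_bil x y z : bilin (fun a bc => tlift (fun b c => phi4 x y z a b c) bc).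
Proof.
split=> w; last exact: tlift_linear.
by apply: linear_tlift => b c e p q; rewrite /phi4 tens_linr tens_linl.
Qed.

Let phi2_bil1 x t : bilin (fun y z => phi3 x y z t).
Proof.
split=> w; apply: linear_tlift => a bc; apply: linear_tlift => b c e p q;
  rewrite /phi4.
  by rewrite tens_linl tens_linl tens_linr.
by rewrite tens_linl !tens_linr.
Qed.

Let phi2_bil t : bilin (fun x yz => tlift (fun y z => phi3 x y z t) yz).
Proof.
split=> w; last exact: tlift_linear.
apply: linear_tlift => y z; apply: linear_tlift => a bc.
by apply: linear_tlift => b c e p q; rewrite /phi4 !tens_linl.
Qed.

Lemma tensor_comulA t :
  tlift (fun x y => tlift (fun x1 x2 => x1 \ox (x2 \ox y)) (tensor_comul x))
    (tensor_comul t) = tlift (fun x y => x \ox tensor_comul y) (tensor_comul t).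
Proof.
have b1 (y : T) : bilin (fun (x1 x2 : T) => x1 \ox (x2 \ox y)).
  by split=> z c p q /=; rewrite ?tens_linl ?tens_linr // tens_linl.
have b2 : bilin (fun x y : T =>
    tlift (fun x1 x2 => x1 \ox (x2 \ox y)) (tensor_comul x)).
  split=> z; last first.
    by apply: linear_tlift => x1 x2 c p q; rewrite !tens_linr.
  by apply: linear_compl; [apply: tlift_linear | apply: tensor_comul_linear].
have b3 : bilin (fun x y : T => x \ox tensor_comul y).
  by split=> z c p q /=; rewrite ?tens_linl // linearP tens_linr.
move: t; apply: (tensor_linear_eq
  (f := fun t => tlift (fun x y =>
          tlift (fun x1 x2 => x1 \ox (x2 \ox y)) (tensor_comul x)) (tensor_comul t))
  (g := fun t => tlift (fun x y => x \ox tensor_comul y) (tensor_comul t))).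
- exact: (linear_compl (tlift_linear b2) tensor_comul_linear).
- exact: (linear_compl (tlift_linear b3) tensor_comul_linear).
move=> u a; rewrite tensor_comul_tens.
rewrite (tlift_comp _ (tlift_linear b2)) (tlift_comp _ (tlift_linear b3)).
transitivity (phi2 (tlift (fun x y => tlift (fun x1 x2 => x1 \ox (x2 \ox y)) (comul x)) (comul a))
  (tlift (fun x y => tlift (fun x1 x2 => x1 \ox (x2 \ox y)) (comul x)) (comul u))).
  rewrite /phi2 (tlift_comp _ (tlift_linear (phi2_bil _))).
  apply: eq_tlift => u1 u2.
  rewrite (tlift_comp _ (tlift_linear (phi2_bil _))).
  rewrite (tlift_comp _ (tlift_linear b2)).
  transitivity (tlift (fun u11 u12 => tlift (fun a1 a2 => tlift (fun a11 a12 =>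
    phi4 u11 u12 u2 a11 a12 a2) (comul a1)) (comul a)) (comul u1)); last first.
    apply: eq_tlift => u11 u12.
    rewrite tlift_tens // tlift_tens // /phi3 (tlift_comp _ (tlift_linear (phi3_bil _ _ _))).
    apply: eq_tlift => a1 a2; rewrite (tlift_comp _ (tlift_linear (phi3_bil _ _ _))).
    by apply: eq_tlift => a11 a12; rewrite !tlift_tens.
  rewrite [RHS]/tlift [X in _ = X]exchange_big; apply: eq_bigr => -[a1 a2] _ /=.
  rewrite tlift_tens // tensor_comul_tens (tlift_comp _ (tlift_linear (b1 _))).
  apply: eq_bigr => -[u11 u12] _ /=; rewrite (tlift_comp _ (tlift_linear (b1 _))).
  by apply: eq_tlift => a11 a12; rewrite tlift_tens.
rewrite !comulA.
rewrite /phi2 (tlift_comp _ (tlift_linear (phi2_bil _))).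
apply: eq_tlift => u1 u2; rewrite tlift_tens //.
rewrite (tlift_comp _ (tlift_linear b3)).
transitivity (tlift (fun a1 a2 => tlift (fun u21 u22 => tlift (fun a21 a22 =>
    phi4 u1 u21 u22 a1 a21 a22) (comul a2)) (comul u2)) (comul a)); last first.
  apply: eq_tlift => a1 a2.
  rewrite tlift_tens // tensor_comul_tens (tlift_comp _ (tens_linr _)).
  apply: eq_tlift => u21 u22; rewrite (tlift_comp _ (tens_linr _)).
  exact: eq_tlift.
rewrite [RHS]/tlift [X in _ = X]exchange_big; apply: eq_bigr => -[u21 u22] _ /=.
rewrite /phi3 (tlift_comp _ (tlift_linear (phi3_bil _ _ _))).
by apply: eq_bigr => -[a1 a2] _ /=; rewrite tlift_tens.
Qed.

HB.instance Definition _ := isCoalgebra.Build k T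
  tensor_comulA tensor_counit_comull tensor_counit_comulr.

End TensorCoalgebra.

Definition Alg (k : fieldType) (B : bialgType k) := {lrmorphism B -> k | *%R}.

Section AlgConv.
Variables (k : fieldType) (B : bialgType k) (f g : Alg B).

Definition alg_conv (b : B) : k := conv f g b.

Let bil : bilin (fun x y : B => f x * g y : k^o).
Proof.
split=> u c x y /=; rewrite linearP.
  by rewrite mulrDl -mulrA.
by rewrite mulrDr mulrCA.
Qed.

Lemma alg_conv_linear : scalar alg_conv.
Proof.
by move=> c x y; rewrite /alg_conv /conv linearP (tlift_linear bil).
Qed.

Lemma alg_conv_monoid_morphism : monoid_morphism alg_conv.
Proof.
have [D1 DM] := comul_monoid_morphism (s := B).
split=> [|x y]; rewrite /alg_conv /conv ?D1 ?DM.
  by rewrite tlift_tens // !rmorph1 mulr1.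
move: (comul x) (comul y) => s t; move: s.
apply: (tensor_linear_eq (U := B) (V := B) (W := k^o)
  (f := fun s => tlift (fun x y => f x * g y : k^o) (s * t))
  (g := fun s => tlift (fun x y => f x * g y : k^o) s *
                 tlift (fun x y => f x * g y : k^o) t)).
- apply: (linear_compl (tlift_linear bil)).
  exact: tmul_linl.
- move=> c p q; rewrite (tlift_linear bil).
  by rewrite mulrDl -scalerAl.
move=> u v; move: t.
apply: (tensor_linear_eq (U := B) (V := B) (W := k^o)
  (f := fun t => tlift (fun x y => f x * g y : k^o) (u \ox v * t))
  (g := fun t => tlift (fun x y => f x * g y : k^o) (u \ox v) *
                 tlift (fun x y => f x * g y : k^o) t)).
- apply: (linear_compl (tlift_linear bil)).
  exact: tmul_linr.
- move=> c p q; rewrite (tlift_linear bil).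
  by rewrite mulrDr -scalerAr.
by move=> u' v'; rewrite tensM !tlift_tens // !rmorphM mulrACA.
Qed.

HB.instance Definition _ := GRing.isLinear.Build k B k _ alg_conv alg_conv_linear.
HB.instance Definition _ :=
  GRing.isMonoidMorphism.Build B k alg_conv alg_conv_monoid_morphism.

Definition alg_mul : Alg B := alg_conv.

End AlgConv.

Section AlgTheory.
Variables (k : fieldType) (B : bialgType k).

Definition alg_counit_fun (b : B) : k := counit b.

Lemma alg_counit_linear : scalar alg_counit_fun.
Proof. exact: linearP. Qed.

HB.instance Definition _ :=
  GRing.isLinear.Build k B k _ alg_counit_fun alg_counit_linear.
HB.instance Definition _ :=
  GRing.isMonoidMorphism.Build B k alg_counit_fun (counit_monoid_morphism (s := B)).

Definition alg_counit : Alg B := alg_counit_fun.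

Lemma Alg_ext (f g : Alg B) : f =1 g -> f = g.
Proof.
case: f g => [f [[a1] [a2] [a3]]] [g [[b1] [b2] [b3]]] /= fg.
have {}fg : f = g by apply/funext.
move: b1 b2 b3; rewrite -{}fg => b1 b2 b3.
have -> : a1 = b1 by case: a1 b1 => ? ? [? ?]; congr pair; apply: Prop_irrelevance.
have -> : a2 = b2 by case: a2 b2 => ? ? [? ?]; congr pair; apply: Prop_irrelevance.
by have -> : a3 = b3 by apply: Prop_irrelevance.
Qed.

Definition determined_by_grouplikes := forall f g : Alg B,
  (forall x : B, grouplike x -> f x = g x) -> f = g.

Definition has_antipode := exists S : {linear B -> B}, forall b : B,
  tlift (fun x y => S x * y) (comul b) = counit b *: 1 /\
  tlift (fun x y => x * S y) (comul b) = counit b *: 1.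

End AlgTheory.

Definition comm_monoid_law (T : Type) (op : T -> T -> T) (e : T) : Prop :=
  [/\ associative op, commutative op & left_id e op].

Definition abelian_group_law (T : Type) (op : T -> T -> T) (e : T) : Prop :=
  comm_monoid_law op e /\ forall x, exists y, op y x = e.

Local Open Scope classical_set_scope.

Section Subspaces.
Variables (k : fieldType) (M : lmodType k).

Definition has_dim (n : nat) : Prop :=
  exists f : {linear M -> 'rV[k]_n}, bijective f.

Definition finite_dim : Prop := exists n, has_dim n.

Definition line (m : M) : set M := [set x | exists c : k, x = c *: m].

Definition dim1 (N : set M) : Prop := exists2 m : M, m <> 0 & N = line m.

(** The class of [m] is a basis of the quotient by [N]. *)
Definition codim1 (N : set M) : Prop :=
  exists2 m : M, ~ N m & forall x, exists c : k, N (x - c *: m).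

(** The sum of a family of subspaces. *)
Definition sum_subspaces (F : set (set M)) : set M :=
  [set x | exists2 s : seq M,
     (forall y, y \in s -> exists2 N, F N & N y) & x = \sum_(y <- s) y].

End Subspaces.

Record is_subspace (k : fieldType) (M : lmodType k) (N : set M) : Prop :=
  IsSubspace {
    subspace0 : N 0;
    subspaceD : forall x y, N x -> N y -> N (x + y);
    subspaceZ : forall (c : k) x, N x -> N (c *: x)
  }.

Section QuotientModule.
Variables (k : fieldType) (M : lmodType k) (N : set M) (hN : is_subspace N).

Definition subspace_pred of is_subspace N : {pred M} := fun x => `[< N x >].

Lemma subspace_zmod_closed : zmod_closed (subspace_pred hN).
Proof.
split=> [|x y /asboolP Nx /asboolP Ny]; apply/asboolP; first exact: subspace0.
by apply: subspaceD => //; rewrite -scaleN1r; apply: subspaceZ.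
Qed.

HB.instance Definition _ :=
  GRing.isZmodClosed.Build M (subspace_pred hN) subspace_zmod_closed.

Definition quotmod := Quotient.quot (subspace_pred hN).
HB.instance Definition _ := GRing.Zmodule.on quotmod.
HB.instance Definition _ : EqQuotient M (Quotient.equiv (subspace_pred hN)) quotmod :=
  EqQuotient.on quotmod.

Definition quotmod_pi (x : M) : quotmod := \pi_quotmod x.

Lemma quotmod_piP x y : quotmod_pi x = quotmod_pi y <-> N (x - y).
Proof.
split=> [/eqmodP|h]; first by rewrite /= Quotient.equivE => /asboolP.
by apply/eqmodP; rewrite /= Quotient.equivE; apply/asboolP.
Qed.

Lemma quotmod_piK q : quotmod_pi (repr q) = q. Proof. exact: reprK. Qed.

Definition quotmod_scale (c : k) (q : quotmod) := quotmod_pi (c *: repr q).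

Lemma quotmod_scale_pi c x : quotmod_scale c (quotmod_pi x) = quotmod_pi (c *: x).
Proof.
by apply/quotmod_piP; rewrite -scalerBr; apply: subspaceZ => //; apply/quotmod_piP/quotmod_piK.
Qed.

Lemma quotmod_piD x y : quotmod_pi (x + y) = quotmod_pi x + quotmod_pi y.
Proof. exact: (raddfD (\pi_(Quotient.quot (subspace_pred hN)))). Qed.

Lemma quotmod_scaleA a b q :
  quotmod_scale a (quotmod_scale b q) = quotmod_scale (a * b) q.
Proof. by rewrite -(quotmod_piK q) !quotmod_scale_pi scalerA. Qed.
Lemma quotmod_scale1 : left_id 1 quotmod_scale.
Proof. by move=> q; rewrite -(quotmod_piK q) quotmod_scale_pi scale1r. Qed.
Lemma quotmod_scaleDr : right_distributive quotmod_scale +%R.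
Proof.
move=> a q r; rewrite -(quotmod_piK q) -(quotmod_piK r) -quotmod_piD.
by rewrite !quotmod_scale_pi scalerDr quotmod_piD.
Qed.
Lemma quotmod_scaleDl q : {morph quotmod_scale^~ q : a b / a + b}.
Proof.
by move=> a b; rewrite -(quotmod_piK q) !quotmod_scale_pi scalerDl quotmod_piD.
Qed.

HB.instance Definition _ := GRing.Zmodule_isLmodule.Build k quotmod
  quotmod_scaleA quotmod_scale1 quotmod_scaleDr quotmod_scaleDl.

Lemma quotmod_pi_linear : linear quotmod_pi.
Proof. by move=> a x y; rewrite quotmod_piD -quotmod_scale_pi. Qed.

HB.instance Definition _ :=
  GRing.isLinear.Build k M quotmod _ quotmod_pi quotmod_pi_linear.

End QuotientModule.

(** [B] is a vector space with a multiplication [mulB] and a unit [oneB]; a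
    left module is a vector space [M] with an action [act] satisfying
    [is_module]. *)

Section Modules.
Variables (k : fieldType) (B : lmodType k) (mulB : B -> B -> B) (oneB : B).

Record is_module (M : lmodType k) (act : B -> M -> M) : Prop := IsModule {
  act_linearl : forall m, linear (act^~ m);
  act_linearr : forall b, linear (act b);
  act_one : forall m, act oneB m = m;
  act_mul : forall b c m, act (mulB b c) m = act b (act c m)
}.

Record is_submodule (M : lmodType k) (act : B -> M -> M) (N : set M) : Prop :=
  IsSubmodule {
    submod0 : N 0;
    submodD : forall x y, N x -> N y -> N (x + y);
    submodZ : forall c x, N x -> N (c *: x);
    submod_act : forall b x, N x -> N (act b x)
  }.

Definition irreducible (M : lmodType k) (act : B -> M -> M) : Prop :=
  (exists m : M, m <> 0) /\
  forall N, is_submodule act N -> N = [set 0] \/ N = setT.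

Definition generates (M : lmodType k) (act : B -> M -> M) (m : M) : Prop :=
  forall N, is_submodule act N -> N m -> N = setT.

Definition module_iso (M M' : lmodType k) (act : B -> M -> M)
    (act' : B -> M' -> M') : Prop :=
  exists2 f : {linear M -> M'}, bijective f &
    forall b m, f (act b m) = act' b (f m).

End Modules.

Section Twist.
Variables (k : fieldType) (U A : bialgType k).
Local Notation H := (tensor U A).

Record skew_pairing (tau : {scalar H}) : Prop := SkewPairing {
  skew_mulr : forall (u : U) (a a' : A), tau (u \ox (a * a')) =
    tlift (fun u1 u2 => tau (u2 \ox a) * tau (u1 \ox a') : k^o) (comul u);
  skew_1l : forall a : A, tau (1 \ox a) = counit a;
  skew_mull : forall (u u' : U) (a : A), tau ((u * u') \ox a) =
    tlift (fun a1 a2 => tau (u \ox a1) * tau (u' \ox a2) : k^o) (comul a);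
  skew_1r : forall u : U, tau (u \ox 1) = counit u
}.

Variables (tau tauV : {scalar H}).

(** The product of [u (x) a] and [u' (x) a'] in [H = (U (x) A)^sigma], where
    [tauV] stands for the convolution inverse of [tau]. *)
Definition twist_pure (u : U) (a : A) (u' : U) (a' : A) : H :=
  sweedler3 (fun u1 u2 u3 =>
    sweedler3 (fun a1 a2 a3 =>
      (tau (u1 \ox a1) * tauV (u3 \ox a3)) *: ((u * u2) \ox (a2 * a'))) a) u'.

(** Its bilinear extension, see [twist_mul_tens]. *)
Definition twist_mul (x y : H) : H :=
  tlift (fun u a => tlift (fun u' a' => twist_pure u a u' a') y) x.

Definition twist_one : H := 1 \ox 1.

Lemma sweedler3_linear (C : coalgType k) (W : lmodType k) (f : C -> C -> C -> W) :
  (forall y z, linear (fun x => f x y z)) ->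
  (forall x z, linear (fun y => f x y z)) ->
  (forall x y, linear (fun z => f x y z)) -> linear (sweedler3 f).
Proof.
move=> f1 f2 f3.
have b : bilin (fun x y => tlift (fun y1 y2 => f x y1 y2) (comul y)).
  split=> w; first by apply: linear_tlift.
  by move=> c x y; rewrite linearP tlift_linear.
by move=> c x y; rewrite /sweedler3 linearP (tlift_linear b).
Qed.

Lemma linear_sweedler3 (C : coalgType k) (W Z : lmodType k)
    (h : Z -> C -> C -> C -> W) c :
  (forall x y z, linear (fun w => h w x y z)) ->
  linear (fun w => sweedler3 (h w) c).
Proof. by move=> lh; apply: linear_tlift => x yz; apply: linear_tlift. Qed.

Let linP (f : {scalar H}) c x y : f (c *: x + y) = c * f x + f y.
Proof. exact: linearP. Qed.

Let lin_pure1 a u' a' : linear (fun u => twist_pure u a u' a').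
Proof.
apply: linear_sweedler3 => u1 u2 u3; apply: linear_sweedler3 => a1 a2 a3 c x y.
by rewrite mulrDl -scalerAl tens_linl scalerDr !scalerA [c * _]mulrC.
Qed.

Let lin_pure2 u u' a' : linear (fun a => twist_pure u a u' a').
Proof.
have scZ (s : k) (t : H) c : s *: (c *: t) = c *: (s *: t).
  by rewrite !scalerA mulrC.
apply: linear_tlift => u1 u23; apply: linear_tlift => u2 u3.
apply: sweedler3_linear => a1 a2 c x y.
1-3: first [by rewrite tens_linr linP mulrDl scalerDl -mulrA scalerA
|by rewrite mulrDl -scalerAl tens_linr scalerDr scZ
|by rewrite tens_linr linP mulrDr scalerDl mulrCA scalerA].
Qed.

Let lin_pure3 u a a' : linear (fun u' => twist_pure u a u' a').
Proof.
have scZ (s : k) (t : H) c : s *: (c *: t) = c *: (s *: t).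
  by rewrite !scalerA mulrC.
apply: sweedler3_linear => u1 u2; apply: linear_sweedler3 => a1 a2 a3 c x y.
1-3: first [by rewrite tens_linl linP mulrDl scalerDl -mulrA scalerA
|by rewrite mulrDr -scalerAr tens_linl scalerDr scZ
|by rewrite tens_linl linP mulrDr scalerDl mulrCA scalerA].
Qed.

Let lin_pure4 u a u' : linear (fun a' => twist_pure u a u' a').
Proof.
apply: linear_sweedler3 => u1 u2 u3; apply: linear_sweedler3 => a1 a2 a3 c x y.
by rewrite mulrDr -scalerAr tens_linr scalerDr !scalerA [c * _]mulrC.
Qed.

Lemma twist_mul_tens u a u' a' :
  twist_mul (u \ox a) (u' \ox a') = twist_pure u a u' a'.
Proof.
have b1 : bilin (twist_pure u a) by split.
have b2 : bilin (fun u a => tlift (twist_pure u a) (u' \ox a')).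
  by split=> w; apply: linear_tlift.
by rewrite /twist_mul tlift_tens // tlift_tens.
Qed.

Lemma twist_mul_linearl y : linear (twist_mul^~ y).
Proof. by apply: tlift_linear; split=> w; apply: linear_tlift. Qed.

Lemma twist_mul_linearr x : linear (twist_mul x).
Proof. by apply: linear_tlift => u a; apply: tlift_linear; split. Qed.

Local Notation is_H_module := (is_module twist_mul twist_one).

(** Restriction of an action of [H] along [u |-> u (x) 1], [a |-> 1 (x) a]. *)
Definition resU (M : lmodType k) (act : H -> M -> M) (u : U) : M -> M :=
  act (u \ox 1).
Definition resA (M : lmodType k) (act : H -> M -> M) (a : A) : M -> M :=
  act (1 \ox a).

(** Being an object of the category [_H M]. *)
Record in_HM (M : lmodType k) (act : H -> M -> M) : Prop := InHM {
  HM_module : is_H_module act;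
  HM_generated : exists m : M,
    [/\ m <> 0, is_submodule (resA act) (line m) & generates act m];
  HM_cogenerated : exists N : set M,
    [/\ is_submodule (resU act) N, codim1 N &
        forall P, is_submodule act P -> (P `<=` N) -> P = [set 0]]
}.

Record HM_obj := HMObj {
  HM_sort : lmodType k;
  HM_act : H -> HM_sort -> HM_sort;
  HM_prop : in_HM HM_act
}.

(** Isomorphism classes, as predicates on objects. *)
Definition HM_class_of (X : HM_obj) : HM_obj -> Prop :=
  fun Y => module_iso (@HM_act X) (@HM_act Y).

Definition HM_classes : Type :=
  {C : HM_obj -> Prop | exists X, C = HM_class_of X}.

Definition HM_class (X : HM_obj) : HM_classes :=
  exist _ (HM_class_of X) (ex_intro _ X erefl).

Section ULmodules.
Variables (rho : Alg U) (chi : Alg A).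

(** [id_U (x) chi] *)
Definition id_chi (t : H) : U := tlift (fun u a => chi a *: u) t.

(** The action of [H] on [U_chi], see [Uact_tens]. *)
Definition Uact (h : H) (u' : U) : U :=
  tlift (fun u a => u * id_chi (twist_mul (1 \ox a) (u' \ox 1))) h.

Lemma id_chi_linear : linear id_chi.
Proof.
apply: tlift_linear; split=> w c x y /=.
  by rewrite scalerDr !scalerA mulrC.
by rewrite linearP scalerDl scalerA.
Qed.

Lemma id_chi_tens u a : id_chi (u \ox a) = chi a *: u.
Proof.
rewrite /id_chi tlift_tens //; split=> w c x y /=.
  by rewrite scalerDr !scalerA mulrC.
by rewrite linearP scalerDl scalerA.
Qed.

Lemma Uact_tens u a u' :
  Uact (u \ox a) u' = u * id_chi (twist_mul (1 \ox a) (u' \ox 1)).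
Proof.
rewrite /Uact tlift_tens //; split=> w c x y /=.
  by rewrite mulrDl scalerAl.
by rewrite tens_linr twist_mul_linearl id_chi_linear mulrDr scalerAr.
Qed.

Lemma Uact_linearr h : linear (Uact h).
Proof.
apply: linear_tlift => u a c x y.
by rewrite tens_linl twist_mul_linearr id_chi_linear mulrDr scalerAr.
Qed.

(** [I(rho, chi)], the sum of the submodules of [U_chi] inside [Ker rho]. *)
Definition Iset : set U :=
  sum_subspaces [set N | is_submodule Uact N /\ (N `<=` [set u | rho u = 0])].

Lemma Iset_subspace : is_subspace Iset.
Proof.
split; first by exists [::]; rewrite ?big_nil.
- move=> x y [s Hs ->] [t Ht ->]; exists (s ++ t); last by rewrite big_cat.
  by move=> z; rewrite mem_cat => /orP[/Hs|/Ht].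
- move=> c x [s Hs ->]; exists [seq c *: z | z <- s]; last first.
    by rewrite big_map scaler_sumr.
  move=> z /mapP[w /Hs[N FN Nw] ->]; exists N => //.
  by case: FN => + _ => /submodZ; apply.
Qed.

Lemma Iset_act h u : Iset u -> Iset (Uact h u).
Proof.
have U0 : Uact h 0 = 0.
  by have /(_ (-1) 0 0) := Uact_linearr h; rewrite !scaler0 addr0 scaleN1r addNr.
have UD x y : Uact h (x + y) = Uact h x + Uact h y.
  by have /(_ 1 x y) := Uact_linearr h; rewrite !scale1r.
move=> [s Hs ->]; exists [seq Uact h y | y <- s]; last first.
  by rewrite big_map; apply: (big_morph _ UD U0).
move=> z /mapP[y /Hs[N FN Ny] ->]; exists N => //.
by case: FN => + _ => /submod_act; apply.
Qed.

Definition L := quotmod Iset_subspace.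

(** Does not depend on the representative, see [Lact_pi]. *)
Definition Lact (h : H) (q : L) : L := quotmod_pi Iset_subspace (Uact h (repr q)).

Lemma Lact_pi h u :
  Lact h (quotmod_pi Iset_subspace u) = quotmod_pi Iset_subspace (Uact h u).
Proof.
apply/quotmod_piP.
have -> : Uact h (repr (quotmod_pi Iset_subspace u)) - Uact h u =
  Uact h (repr (quotmod_pi Iset_subspace u) - u).
  have /(_ (-1) u (repr (quotmod_pi Iset_subspace u))) := Uact_linearr h.
  by rewrite !scaleN1r addrC => <-; rewrite addrC.
apply: Iset_act; exact/(quotmod_piP Iset_subspace)/quotmod_piK.
Qed.

End ULmodules.

End Twist.

(* Main.v *)
Require Import Defs.
From HB Require Import structures.
From mathcomp Require Import all_boot all_algebra.
From mathcomp Require Import boolp classical_sets.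

Set Implicit Arguments.
Unset Strict Implicit.
Unset Printing Implicit Defensive.

Import GRing.Theory.
Local Open Scope ring_scope.
Local Open Scope classical_set_scope.

(** A module generated by an [A]-eigenvector [m] of character [chi] and having
    a functional [pi] of [U]-character [rho], normalized by [pi m = 1], whose
    kernel contains no nonzero submodule, is the quotient of [U_chi] by
    [I(rho, chi)].  Since [Alg(U, k)] is commutative, conjugation by the
    character [tau(-, x)], for [x] grouplike in [A], is trivial, and therefore
    [pi (x v) = chi x * pi v] for every [v].  As [pi] cannot vanish on an
    [A]-eigenvector, all [A]-eigenvectors have the same character [chi] and are
    multiples of [m].  Dually, every grouplike [g] of [U] sends [m] to an
    [A]-eigenvector of character [chi], hence to [rho g *: m], so that [rho] is
    determined by the module as well. *)

(** * Sweedler calculus *)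

(** The axioms concern [tau] only, while the product of [H] also involves [tauV]. The product rules
    of [tauV] come from uniqueness of convolution inverses: [tauV] after a multiplication, and the
    expected product formula, both invert [tau] after that multiplication. The same argument makes a
    character composed with an antipode again a character, whence inverses of characters.

    The action of [A] on [U_chi] is split into two commuting hit actions, one through [tau] and one
    through [tauV], with [chi] between them. This is the origin of the conjugation: a grouplike [x]
    acts by [chi x] times [u |-> tau(u_(1), x) u_(2) tauV(u_(3), x)], and applying [rho] produces
    [rho] conjugated by [tau(-, x)]. *)

Section Linearity.
Variables (k : fieldType) (X Y Z W : lmodType k).

Lemma lin_id : linear (fun x : X => x).
Proof. by []. Qed.

Lemma lin_morph (f : {linear X -> Y}) : linear f.
Proof. exact: linearP. Qed.

Lemma lin_scalar (f : {scalar X}) : linear (f : X -> k^o).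
Proof. exact: linearP. Qed.

Lemma lin_tensl (f : X -> Y) (z : Z) : linear f -> linear (fun x => f x \ox z).
Proof. by move=> lf a x y; rewrite lf tens_linl. Qed.

Lemma lin_tensr (f : X -> Y) (z : Z) : linear f -> linear (fun x => z \ox f x).
Proof. by move=> lf a x y; rewrite lf tens_linr. Qed.

Lemma lin_scalel (f : X -> k^o) (z : Z) : linear f -> linear (fun x => f x *: z).
Proof. by move=> lf a x y; rewrite lf scalerDl scalerA. Qed.

Lemma lin_scaler (f : X -> Y) (c : k) : linear f -> linear (fun x => c *: f x).
Proof. by move=> lf a x y; rewrite lf scalerDr !scalerA mulrC. Qed.

Lemma lin_mulkl (f : X -> k^o) (c : k) :
  linear f -> linear (fun x => (f x : k) * c : k^o).
Proof. by move=> lf a x y; rewrite lf mulrDl -mulrA. Qed.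

Lemma lin_mulkr (f : X -> k^o) (c : k) :
  linear f -> linear (fun x => c * (f x : k) : k^o).
Proof. by move=> lf a x y; rewrite lf mulrDr mulrCA. Qed.

Lemma lin_mull (R : algType k) (f : X -> R) (c : R) :
  linear f -> linear (fun x => f x * c).
Proof. by move=> lf a x y; rewrite lf mulrDl scalerAl. Qed.

Lemma lin_mulr (R : algType k) (f : X -> R) (c : R) :
  linear f -> linear (fun x => c * f x).
Proof. by move=> lf a x y; rewrite lf mulrDr scalerAr. Qed.

Lemma lin_tlift_arg (f : X -> Y -> Z) (g : W -> tensor X Y) :
  bilin f -> linear g -> linear (fun w => tlift f (g w)).
Proof. by move=> bf lg a x y; rewrite lg tlift_linear. Qed.

Lemma linear0P (f : X -> Y) : linear f -> f 0 = 0.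
Proof. by move=> lf; have := lf (-1) 0 0; rewrite scaler0 addr0 scaleN1r addNr. Qed.

Lemma linearDP (f : X -> Y) : linear f -> {morph f : x y / x + y}.
Proof. by move=> lf x y; have := lf 1 x y; rewrite !scale1r. Qed.

Lemma linearZP (f : X -> Y) c : linear f -> {morph f : x / c *: x}.
Proof. by move=> lf x; have := lf c x 0; rewrite !addr0 (linear0P lf) addr0. Qed.

End Linearity.

(** Proves that an expression containing a variable exactly once, under
    linear operations only, is linear in it. *)
Ltac lin1 :=
  lazymatch goal with
  | |- bilin _ => first [ match goal with H : _ |- _ => solve [exact: H] end
                        | split; intro; cbv beta ]
  | |- linear (fun x => x) => exact: lin_id
  | |- _ => first
    [ match goal with H : _ |- _ => solve [exact: H] end
    | match goal with
      | |- linear (fun x => @?f x \ox ?z) => refine (@lin_tensl _ _ _ _ f z _)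
      | |- linear (fun x => ?z \ox @?f x) => refine (@lin_tensr _ _ _ _ f z _)
      | |- linear (fun x => ?z *: @?f x) => refine (@lin_scaler _ _ _ f z _)
      | |- linear (fun x => @?f x *: ?z) => refine (@lin_scalel _ _ _ f z _)
      | |- linear (fun x => @?f x * ?z) => refine (@lin_mulkl _ _ f z _)
      | |- linear (fun x => ?z * @?f x) => refine (@lin_mulkr _ _ f z _)
      | |- linear (fun x => @?f x * ?z) => refine (@lin_mull _ _ _ f z _)
      | |- linear (fun x => ?z * @?f x) => refine (@lin_mulr _ _ _ f z _)
      | |- linear (fun x => @tlift _ ?U ?V ?W (@?f x) ?t) =>
          refine (@linear_tlift _ U V W _ f t _); intros
      | |- linear (fun x => @tlift _ ?U ?V ?W ?f (@?t x)) =>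
          refine (@lin_tlift_arg _ U V W _ f t _ _)
      | |- linear (fun x => @GRing.Linear.sort _ _ _ *:%R ?f (@?g x)) =>
          refine (@linear_compl _ _ _ _ f g (lin_morph f) _)
      | |- linear (fun x => @GRing.Linear.sort _ _ _ _ ?f (@?g x)) =>
          refine (@linear_compl _ _ _ _ (f : _ -> _^o) g (lin_scalar f) _)
      | |- linear ( *%R ?z) => refine (@lin_mulr _ _ _ id z _)
      | |- linear (tlift _) => apply: tlift_linear
      | |- linear ?f => exact: (lin_morph f)
      | |- linear ?f => exact: (lin_scalar f)
      | |- linear (fun x => ?f x ?z) => fail 1
      | |- linear (fun x => ?f (@?g x) ?z) =>
          refine (@linear_compl _ _ _ _ (fun y => f y z) g _ _)
      | |- linear (fun x => ?f (@?g x)) =>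
          first [ refine (@linear_compl _ _ _ _ f g _ _)
                | refine (@linear_compl _ _ _ _ (f : _ -> _^o) g _ _) ]
      end ]
  end.
Ltac lin := repeat (intros; cbv beta; lin1).

Section Sweedler.
Variables (k : fieldType) (C : coalgType k).

(** Coassociativity, pushed through the linear map that the trilinear [f] induces on the triple
    tensor product. Since [sweedler3] splits the right leg, this normalizes expressions in which the
    left leg is split. *)
Lemma sweedlerA (W : lmodType k) (f : C -> C -> C -> W) c :
  (forall y z, linear (fun x => f x y z)) ->
  (forall x z, linear (fun y => f x y z)) ->
  (forall x y, linear (fun z => f x y z)) ->
  tlift (fun x y => tlift (fun x1 x2 => f x1 x2 y) (comul x)) (comul c) =
  sweedler3 f c.
Proof.
move=> f1 f2 f3; pose F := tlift (fun x t => tlift (f x) t).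
have bF : bilin (fun x t => tlift (f x) t) by lin.
have lF : linear F by exact: tlift_linear.
transitivity (F (tlift (fun x y => tlift (fun x1 x2 => x1 \ox (x2 \ox y)) (comul x)) (comul c))).
  rewrite (tlift_comp _ lF); apply: eq_tlift => x y.
  rewrite (tlift_comp _ lF); apply: eq_tlift => x1 x2.
  by rewrite /F !tlift_tens.
rewrite comulA (tlift_comp _ lF); apply: eq_tlift => x y.
by rewrite /F tlift_tens.
Qed.

Lemma counitl (W : lmodType k) (f : C -> W) c : linear f ->
  tlift (fun x y => counit x *: f y) (comul c) = f c.
Proof.
move=> lf; rewrite -{2}[c]counit_comull (tlift_comp _ lf).
by apply: eq_tlift => x y; rewrite linearZP.
Qed.

Lemma counitr (W : lmodType k) (f : C -> W) c : linear f ->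
  tlift (fun x y => counit y *: f x) (comul c) = f c.
Proof.
move=> lf; rewrite -{2}[c]counit_comulr (tlift_comp _ lf).
by apply: eq_tlift => x y; rewrite linearZP.
Qed.

End Sweedler.

Section Convolution.
Variables (k : fieldType) (C : coalgType k).
Implicit Types f g h : C -> k^o.

Lemma conv_linear f g : linear f -> linear g -> linear (conv f g : C -> k^o).
Proof. by move=> lf lg; rewrite /conv; lin. Qed.

Lemma convA f g h c : linear f -> linear g -> linear h ->
  conv (conv f g) h c = conv f (conv g h) c.
Proof.
move=> lf lg lh.
transitivity (sweedler3 (fun x y z => f x * g y * h z : k^o) c).
  rewrite -sweedlerA; try by lin.
  rewrite {1}/conv; apply: (eq_tlift (W := k^o)) => x y.
  by rewrite (tlift_comp (h := fun s : k^o => s * h y : k^o)) //; lin.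
rewrite /conv; apply: (eq_tlift (W := k^o)) => x y.
rewrite (tlift_comp (h := fun s : k^o => f x * s : k^o)); last by lin.
by apply: eq_tlift => y1 y2; rewrite mulrA.
Qed.

Lemma conv1l f c : linear f -> conv counit f c = f c.
Proof. by move=> lf; rewrite -[RHS](counitl _ lf). Qed.

Lemma conv1r f c : linear f -> conv f counit c = f c.
Proof.
by move=> lf; rewrite -[RHS](counitr _ lf); apply: (eq_tlift (W := k^o)) => x y; rewrite mulrC.
Qed.

Lemma eq_conv f f' g g' : f =1 f' -> g =1 g' -> conv f g =1 conv f' g'.
Proof. by move=> ff gg c; apply: (eq_tlift (W := k^o)) => x y; rewrite ff gg. Qed.

(** A left and a right inverse of one element of a monoid coincide:
    [h = h * (f * g) = (h * f) * g = g]. *)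
Lemma conv_inv_uniq f g h : linear f -> linear g -> linear h ->
  conv h f =1 counit -> conv f g =1 counit -> h =1 g.
Proof.
move=> lf lg lh hf fg c.
rewrite -(conv1r c lh) -(eq_conv (fun=> erefl) fg) -convA //.
by rewrite (eq_conv hf (fun=> erefl)) conv1l.
Qed.

Lemma tlift_grouplike (W : lmodType k) (f : C -> C -> W) (g : C) :
  grouplike g -> bilin f -> tlift f (comul g) = f g g.
Proof. by move=> [-> _] bf; rewrite tlift_tens. Qed.

End Convolution.

Section SweedlerBialgebra.
Variables (k : fieldType) (B : bialgType k).

Lemma comul1 : comul (1 : B) = 1 \ox 1.
Proof. by have [] := comul_monoid_morphism (s := B). Qed.

Lemma counit1 : counit (1 : B) = 1.
Proof. by have [] := counit_monoid_morphism (s := B). Qed.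

Lemma counitM (b c : B) : counit (b * c) = counit b * counit c.
Proof. by have [_ ->] := counit_monoid_morphism (s := B). Qed.

Lemma tlift_comul1 (W : lmodType k) (f : B -> B -> W) :
  bilin f -> tlift f (comul 1) = f 1 1.
Proof. by move=> bf; rewrite comul1 tlift_tens. Qed.

Lemma tlift_comulM (W : lmodType k) (f : B -> B -> W) b c :
  bilin f -> tlift f (comul (b * c)) =
  tlift (fun b1 b2 => tlift (fun c1 c2 => f (b1 * c1) (b2 * c2)) (comul c))
    (comul b).
Proof.
move=> bf; have [_ ->] := comul_monoid_morphism (s := B).
have [f1 f2] := bf.
rewrite -[_ * _]/(tmul _ _) /tmul (tlift_comp _ (tlift_linear bf)).
apply: eq_tlift => b1 b2; rewrite (tlift_comp _ (tlift_linear bf)).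
by apply: eq_tlift => c1 c2; rewrite tlift_tens.
Qed.

Lemma sweedler3_1 (W : lmodType k) (f : B -> B -> B -> W) :
  (forall y z, linear (fun x => f x y z)) ->
  (forall x z, linear (fun y => f x y z)) ->
  (forall x y, linear (fun z => f x y z)) ->
  sweedler3 f 1 = f 1 1 1.
Proof.
by move=> f1 f2 f3; rewrite /sweedler3 !tlift_comul1 //; lin.
Qed.

End SweedlerBialgebra.

Section SweedlerTensor.
Variables (k : fieldType) (U A : coalgType k).

Lemma tlift_comul_tens (W : lmodType k) (f : tensor U A -> tensor U A -> W) u a :
  bilin f -> tlift f (comul (u \ox a)) =
  tlift (fun u1 u2 => tlift (fun a1 a2 => f (u1 \ox a1) (u2 \ox a2)) (comul a))
    (comul u).
Proof.
move=> bf; rewrite [comul _](tensor_comul_tens u a) (tlift_comp _ (tlift_linear bf)).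
apply: eq_tlift => u1 u2; rewrite (tlift_comp _ (tlift_linear bf)).
by apply: eq_tlift => a1 a2; rewrite tlift_tens.
Qed.

Lemma counit_tens (u : U) (a : A) : counit (u \ox a) = counit u * counit a.
Proof. exact: tensor_counit_tens. Qed.

End SweedlerTensor.

(** [tlift] is a finite sum over a representative of the tensor, so this is the interchange of two
    finite sums. *)
Lemma exchange_tlift (k : fieldType) (X Y X' Y' W : lmodType k)
    (f : X -> Y -> X' -> Y' -> W) s t :
  tlift (fun x y => tlift (f x y) t) s =
  tlift (fun x' y' => tlift (fun x y => f x y x' y') s) t.
Proof. exact: exchange_big. Qed.

Section ScalarTlift.
Variables (k : fieldType) (X Y : lmodType k) (f : X -> Y -> k^o).

Lemma tliftMl (c : k) t : c * (tlift f t : k) = tlift (fun x y => c * (f x y : k) : k^o) t.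
Proof. exact: big_distrr. Qed.

Lemma tliftMr (c : k) t : (tlift f t : k) * c = tlift (fun x y => (f x y : k) * c : k^o) t.
Proof. exact: big_distrl. Qed.

Lemma tlift_scalel (W : lmodType k) (w : W) t :
  tlift f t *: w = tlift (fun x y => f x y *: w) t.
Proof. exact: scaler_suml. Qed.

End ScalarTlift.

Lemma tlift_scaler (k : fieldType) (X Y W : lmodType k) (f : X -> Y -> W) c t :
  c *: tlift f t = tlift (fun x y => c *: f x y) t.
Proof. exact: scaler_sumr. Qed.

Section Sweedler4.
Variables (k : fieldType) (C : coalgType k) (W : lmodType k).

(** [f c_(1) c_(2) c_(3) c_(4)], with the inner pair obtained last. *)
Lemma sweedler4_mid (f : C -> C -> C -> C -> W) c :
  (forall y z t, linear (fun x => f x y z t)) ->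
  (forall x z t, linear (fun y => f x y z t)) ->
  (forall x y t, linear (fun z => f x y z t)) ->
  (forall x y z, linear (fun t => f x y z t)) ->
  tlift (fun x y => tlift (fun x1 x2 => tlift (fun y1 y2 => f x1 x2 y1 y2)
    (comul y)) (comul x)) (comul c) =
  sweedler3 (fun x m y => tlift (fun m1 m2 => f x m1 m2 y) (comul m)) c.
Proof.
move=> f1 f2 f3 f4.
rewrite (sweedlerA (f := fun x1 x2 y => tlift (fun y1 y2 => f x1 x2 y1 y2) (comul y))).
- by apply: eq_tlift => x r; rewrite sweedlerA.
- by lin.
- by lin.
- by lin.
Qed.

End Sweedler4.

(** * Convolution inverses of pairings and of characters *)

(** The multiplication [mu] is kept abstract in order to cover both
    the product of a bialgebra and the opposite one. *)
Section PairingInverse.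
Variables (k : fieldType) (C B : coalgType k) (mu : B -> B -> B).
Variables (p q : C -> B -> k).
Hypotheses (mu_bil : bilin mu) (p_bil : bilin (p : C -> B -> k^o))
  (q_bil : bilin (q : C -> B -> k^o)).
Hypothesis comul_mu : forall (W : lmodType k) (f : B -> B -> W) b c, bilin f ->
  tlift f (comul (mu b c)) =
  tlift (fun b1 b2 => tlift (fun c1 c2 => f (mu b1 c1) (mu b2 c2)) (comul c))
    (comul b).
Hypothesis counit_mu : forall b c, counit (mu b c) = counit b * counit c.
Hypothesis pq : forall c b,
  tlift (fun c1 c2 => tlift (fun b1 b2 => p c1 b1 * q c2 b2 : k^o) (comul b))
    (comul c) = counit c * counit b.
Hypothesis qp : forall c b,
  tlift (fun c1 c2 => tlift (fun b1 b2 => q c1 b1 * p c2 b2 : k^o) (comul b))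
    (comul c) = counit c * counit b.
Hypothesis p_mu : forall c b b',
  p c (mu b b') = tlift (fun c1 c2 => p c1 b * p c2 b' : k^o) (comul c).

Local Notation T := (tensor C (tensor B B)).

Let lift3 (f : C -> B -> B -> k) (t : T) : k :=
  tlift (fun c s => tlift (f c : B -> B -> k^o) s) t.

(** Functionals on the coalgebra [T], in whose dual algebra inverses are unique: [G2] is the formula
    claimed for [G1]. *)
Let F := lift3 (fun c b b' => p c (mu b b')).
Let G1 := lift3 (fun c b b' => q c (mu b b')).
Let G2 := lift3 (fun c b b' =>
  tlift (fun c1 c2 => q c2 b * q c1 b' : k^o) (comul c)).

Let mu1 b : linear (mu^~ b). Proof. by have [] := mu_bil. Qed.
Let mu2 b : linear (mu b). Proof. by have [] := mu_bil. Qed.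
Let p1 b : linear (p^~ b : C -> k^o). Proof. by have [] := p_bil. Qed.
Let p2 b : linear (p b : B -> k^o). Proof. by have [] := p_bil. Qed.
Let q1 b : linear (q^~ b : C -> k^o). Proof. by have [] := q_bil. Qed.
Let q2 b : linear (q b : B -> k^o). Proof. by have [] := q_bil. Qed.

Let pm1 b b' : linear (fun c => p c (mu b b') : k^o). Proof. exact: p1. Qed.
Let pm2 c b' : linear (fun b => p c (mu b b') : k^o).
Proof. exact: linear_compl (p2 c) (mu1 b'). Qed.
Let pm3 c b : linear (fun b' => p c (mu b b') : k^o).
Proof. exact: linear_compl (p2 c) (mu2 b). Qed.
Let qm1 b b' : linear (fun c => q c (mu b b') : k^o). Proof. exact: q1. Qed.
Let qm2 c b' : linear (fun b => q c (mu b b') : k^o).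
Proof. exact: linear_compl (q2 c) (mu1 b'). Qed.
Let qm3 c b : linear (fun b' => q c (mu b b') : k^o).
Proof. exact: linear_compl (q2 c) (mu2 b). Qed.

Let lift3_bil (f : C -> B -> B -> k) :
  (forall b b', linear (fun c => f c b b' : k^o)) -> (forall c, bilin (f c : B -> B -> k^o)) ->
  bilin (fun c s => tlift (f c : B -> B -> k^o) s).
Proof. by move=> f1 f2; lin. Qed.

Let lift3_tens (f : C -> B -> B -> k) c b b' :
  (forall b b', linear (fun c => f c b b' : k^o)) -> (forall c, bilin (f c : B -> B -> k^o)) ->
  lift3 f (c \ox (b \ox b')) = f c b b'.
Proof.
by move=> f1 f2; rewrite /lift3 tlift_tens ?tlift_tens //; exact: lift3_bil.
Qed.

Let Fb c : bilin (fun b b' => p c (mu b b') : k^o). Proof. by split. Qed.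
Let G1b c : bilin (fun b b' => q c (mu b b') : k^o). Proof. by split. Qed.
Let G2b c : bilin (fun b b' =>
  tlift (fun c1 c2 => q c2 b * q c1 b' : k^o) (comul c)).
Proof. by lin. Qed.
Let G2l b b' : linear (fun c =>
  tlift (fun c1 c2 => q c2 b * q c1 b' : k^o) (comul c)).
Proof. by lin. Qed.

Let lF : linear (F : T -> k^o). Proof. by apply: tlift_linear; apply: lift3_bil. Qed.
Let lG1 : linear (G1 : T -> k^o). Proof. by apply: tlift_linear; apply: lift3_bil. Qed.
Let lG2 : linear (G2 : T -> k^o). Proof. by apply: tlift_linear; apply: lift3_bil. Qed.

Let T_ext (f g : T -> k) : linear (f : T -> k^o) -> linear (g : T -> k^o) ->
  (forall c b b', f (c \ox (b \ox b')) = g (c \ox (b \ox b'))) -> f =1 g.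
Proof.
move=> lf lg fg; apply: (tensor_linear_eq (W := k^o)) => // c s; move: s.
by apply: (tensor_linear_eq (W := k^o)); [lin | lin | exact: fg].
Qed.

Let conv_tens (f g : T -> k) c b b' :
  linear (f : T -> k^o) -> linear (g : T -> k^o) ->
  conv f g (c \ox (b \ox b')) =
  tlift (fun c1 c2 => tlift (fun b1 b2 => tlift (fun b1' b2' =>
    f (c1 \ox (b1 \ox b1')) * g (c2 \ox (b2 \ox b2')) : k^o)
      (comul b')) (comul b)) (comul c).
Proof.
move=> lf lg; rewrite /conv tlift_comul_tens; last by lin.
apply: (eq_tlift (W := k^o)) => c1 c2; rewrite tlift_comul_tens //; by lin.
Qed.

(** [G1] and [G2] are both convolution inverse to [F]. *)
Let FG1 : conv F G1 =1 counit.
Proof.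
apply: T_ext; [exact: conv_linear | exact: linearP |] => c b b'.
rewrite conv_tens // !counit_tens -counit_mu -pq.
apply: (eq_tlift (W := k^o)) => c1 c2; rewrite comul_mu; last by lin.
by apply: (eq_tlift (W := k^o)) => b1 b2; apply: (eq_tlift (W := k^o)) => b1' b2'; rewrite /F /G1 !lift3_tens.
Qed.

Let G2F : conv G2 F =1 counit.
Proof.
apply: T_ext; [exact: conv_linear | exact: linearP |] => c b b'.
rewrite conv_tens // !counit_tens.
transitivity (tlift (fun c1 c2 => tlift (fun x1 x2 => tlift (fun y1 y2 =>
    tlift (fun b1 b2 => tlift (fun b1' b2' =>
      q x2 b1 * q x1 b1' * (p y1 b2 * p y2 b2') : k^o) (comul b')) (comul b))
        (comul c2)) (comul c1)) (comul c)).
  apply: (eq_tlift (W := k^o)) => c1 c2.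
  transitivity (tlift (fun b1 b2 => tlift (fun b1' b2' =>
    tlift (fun x1 x2 => tlift (fun y1 y2 =>
    q x2 b1 * q x1 b1' * (p y1 b2 * p y2 b2') : k^o) (comul c2)) (comul c1))
      (comul b')) (comul b)).
    apply: (eq_tlift (W := k^o)) => b1 b2; apply: (eq_tlift (W := k^o)) => b1' b2'.
    rewrite /F /G2 !lift3_tens // p_mu tliftMr.
    by apply: (eq_tlift (W := k^o)) => x1 x2; rewrite tliftMl.
  under eq_tlift do (rewrite exchange_tlift; under eq_tlift do rewrite exchange_tlift).
  rewrite exchange_tlift; apply: (eq_tlift (W := k^o)) => x1 x2.
  by rewrite exchange_tlift.
(* The two middle legs of [c] now carry [q * p] against [b], which [qp] collapses to counits. The
   outer legs thereby become adjacent, and [qp] collapses them against [b']. *)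
rewrite (sweedler4_mid (f := fun x1 x2 y1 y2 => tlift (fun b1 b2 =>
  tlift (fun b1' b2' => q x2 b1 * q x1 b1' * (p y1 b2 * p y2 b2') : k^o)
  (comul b')) (comul b))); [|by lin..].
transitivity (sweedler3 (fun x m y => counit m *: (counit b *: tlift
  (fun b1' b2' => q x b1' * p y b2' : k^o) (comul b'))) c).
  apply: (eq_tlift (W := k^o)) => x r; apply: (eq_tlift (W := k^o)) => m y.
  rewrite scalerA -qp tlift_scalel; apply: (eq_tlift (W := k^o)) => x2 y1.
  rewrite tlift_scalel; apply: (eq_tlift (W := k^o)) => b1 b2.
  rewrite -[RHS]/(@GRing.mul k _ _) tliftMl.
  by apply: (eq_tlift (W := k^o)) => b1' b2'; rewrite mulrACA.
rewrite mulrCA -qp tliftMl /sweedler3; apply: (eq_tlift (W := k^o)) => x y.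
by rewrite (counitl (f := fun y => counit b *: tlift
  (fun b1' b2' => q x b1' * p y b2' : k^o) (comul b'))) //; lin.
Qed.

(** By [p_mu], the functional [F] is the convolution product of a pairing with [b] and a pairing
    with [b']. The inverse of a product is the product of the inverses in reverse order, which is
    why the legs of [c] are swapped. *)
Lemma pairing_inverse_mul c b b' :
  q c (mu b b') = tlift (fun c1 c2 => q c2 b * q c1 b' : k^o) (comul c).
Proof.
have := conv_inv_uniq lF lG1 lG2 G2F FG1 (c \ox (b \ox b')).
by rewrite /G1 /G2 !lift3_tens.
Qed.

End PairingInverse.

Section AlgLaws.
Variables (k : fieldType) (B : bialgType k).
Implicit Types f g h : Alg B.

Lemma lin_Alg f : linear (f : B -> k^o).
Proof. exact: linearP. Qed.

Lemma AlgP (f : B -> k) : scalar f -> monoid_morphism f ->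
  exists g : Alg B, g =1 f.
Proof.
move=> sf mf.
pose lf := GRing.isLinear.Build k B k *%R f sf.
pose rf := GRing.isMonoidMorphism.Build B k f mf.
pose g : Alg B := HB.pack f lf rf.
by exists g.
Qed.

Lemma alg_mulA : associative (@alg_mul k B).
Proof.
move=> f g h; apply: Alg_ext => b; apply/esym.
by apply: (@convA k B f g h); apply: lin_Alg.
Qed.

Lemma alg_mul1 : left_id (alg_counit B) (@alg_mul k B).
Proof. by move=> f; apply: Alg_ext => b; apply: conv1l; apply: lin_Alg. Qed.

Lemma alg_mul_grouplike f g x : grouplike x -> alg_mul f g x = f x * g x.
Proof.
move=> gx; have lf := lin_Alg f; have lg := lin_Alg g.
by apply: (tlift_grouplike (W := k^o) gx); lin.
Qed.

(** On a grouplike the convolution product is a product in the field [k]. *)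
Lemma alg_mulC : determined_by_grouplikes B -> commutative (@alg_mul k B).
Proof.
by move=> detB f g; apply: detB => x gx; rewrite !alg_mul_grouplike // mulrC.
Qed.

Lemma alg_mul_law : determined_by_grouplikes B ->
  comm_monoid_law (@alg_mul k B) (alg_counit B).
Proof.
by move=> detB; split; [exact: alg_mulA | exact: alg_mulC | exact: alg_mul1].
Qed.

(** The inverse is [f] composed with the antipode [S]. That it is multiplicative follows from
    uniqueness of convolution inverses. *)
Lemma alg_inverse f : has_antipode B -> exists g, alg_mul g f = alg_counit B.
Proof.
move=> [S SP]; have lf := lin_Alg f.
have lS : linear S by exact: linearP.
have lfS : linear (fun b => f (S b) : k^o) by lin.
have e1 : counit (1 : B) = 1 := counit1 B.
have fS b : tlift (fun x y => f (S x) * f y : k^o) (comul b) = counit b.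
  transitivity (f (tlift (fun x y => S x * y) (comul b))).
    rewrite (tlift_comp (W' := k^o) (h := f)) //.
    by apply: (eq_tlift (W := k^o)) => x y; rewrite rmorphM.
  by rewrite (SP b).1 linearZ /= rmorph1 mulr1.
have Sf b : tlift (fun x y => f x * f (S y) : k^o) (comul b) = counit b.
  transitivity (f (tlift (fun x y => x * S y) (comul b))).
    rewrite (tlift_comp (W' := k^o) (h := f)) //.
    by apply: (eq_tlift (W := k^o)) => x y; rewrite rmorphM.
  by rewrite (SP b).2 linearZ /= rmorph1 mulr1.
have counit2 (c : B) (F : k) :
    tlift (fun c1 c2 => counit c1 * counit c2 * F : k^o) (comul c) = counit c * F.
  rewrite -tliftMr; congr (_ * _).
  exact: (counitl (W := k^o) (f := counit) c (lin_scalar _)).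
have lc : linear (counit : B -> k^o) := lin_scalar counit.
have [g gE] : exists g : Alg B, g =1 (fun b => f (S b)); last first.
  by exists g; apply: Alg_ext => b; rewrite -[RHS]fS; apply: (eq_tlift (W := k^o)) => x y; rewrite gE.
apply: AlgP; first exact: lfS.
split=> [|b b'].
  have := (SP 1).1; rewrite tlift_comul1 ?counit1 ?scale1r; last by lin.
  by rewrite mulr1 => ->; rewrite rmorph1.
(* The character is viewed as a pairing that is trivial in its first variable; taking that variable
   equal to [1] leaves exactly the multiplicativity of [f] composed with [S]. *)
have := @pairing_inverse_mul k B B *%R (fun c b => counit c * f b)
  (fun c b => counit c * f (S b)) _ _ _ _ _ _ _ _ 1 b b'.
rewrite e1 tlift_comul1; last by lin.
rewrite e1 !mul1r; apply.
- by lin.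
- by lin.
- by lin.
- by move=> W F c d; apply: tlift_comulM.
- exact: counitM.
- move=> c d; rewrite -counit2 -Sf; apply: (eq_tlift (W := k^o)) => c1 c2.
  by rewrite tliftMl; apply: (eq_tlift (W := k^o)) => d1 d2; rewrite mulrACA.
- move=> c d; rewrite -counit2 -fS; apply: (eq_tlift (W := k^o)) => c1 c2.
  by rewrite tliftMl; apply: (eq_tlift (W := k^o)) => d1 d2; rewrite mulrACA.
- move=> c d d'; rewrite rmorphM -counit2; apply: (eq_tlift (W := k^o)) => c1 c2.
  by rewrite mulrACA.
Qed.

Lemma alg_mul_group : determined_by_grouplikes B -> has_antipode B ->
  abelian_group_law (@alg_mul k B) (alg_counit B).
Proof.
by move=> detB S; split; [exact: alg_mul_law | move=> f; exact: alg_inverse].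
Qed.

End AlgLaws.

Section SkewPairing.
Variables (k : fieldType) (U A : bialgType k) (tau tauV : {scalar tensor U A}).
Hypotheses (tauP : skew_pairing tau)
  (tauVP : conv_inverse (C := tensor U A) tau tauV).
Implicit Types (u : U) (a : A).

Lemma tau_tauV u a :
  tlift (fun u1 u2 => tlift (fun a1 a2 => tau (u1 \ox a1) * tauV (u2 \ox a2) : k^o)
    (comul a)) (comul u) = counit u * counit a.
Proof.
rewrite -counit_tens -tauVP.1 /conv tlift_comul_tens //; by lin.
Qed.

Lemma tauV_tau u a :
  tlift (fun u1 u2 => tlift (fun a1 a2 => tauV (u1 \ox a1) * tau (u2 \ox a2) : k^o)
    (comul a)) (comul u) = counit u * counit a.
Proof.
rewrite -counit_tens -tauVP.2 /conv tlift_comul_tens //; by lin.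
Qed.

Lemma tauV_1l a : tauV (1 \ox a) = counit a.
Proof.
have := tau_tauV 1 a; rewrite tlift_comul1; last by lin.
rewrite counit1 mul1r => <-.
rewrite -(counitl (W := k^o) (f := fun a => tauV (1 \ox a))); last by lin.
by apply: (eq_tlift (W := k^o)) => a1 a2; rewrite (skew_1l tauP).
Qed.

Lemma tauV_1r u : tauV (u \ox 1) = counit u.
Proof.
have := tau_tauV u 1; rewrite exchange_tlift tlift_comul1; last by lin.
rewrite counit1 mulr1 => <-.
rewrite -(counitl (W := k^o) (f := fun u => tauV (u \ox 1))); last by lin.
by apply: (eq_tlift (W := k^o)) => a1 a2; rewrite (skew_1r tauP).
Qed.

Lemma tauV_mulr u a a' : tauV (u \ox (a * a')) =
  tlift (fun u1 u2 => tauV (u1 \ox a) * tauV (u2 \ox a') : k^o) (comul u).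
Proof.
(* [skew_mulr] distributes the legs of [u] in reverse order, so it has the shape [p_mu] for the
   opposite product of [A]. *)
rewrite (@pairing_inverse_mul k U A (fun a a' => a' * a)
  (fun u a => tau (u \ox a)) (fun u a => tauV (u \ox a))).
- by apply: (eq_tlift (W := k^o)) => u1 u2; rewrite mulrC.
- by lin.
- by lin.
- by lin.
- by move=> W F b c bF; rewrite tlift_comulM // exchange_tlift.
- by move=> b c; rewrite counitM mulrC.
- exact: tau_tauV.
- exact: tauV_tau.
- move=> c b b'; rewrite (skew_mulr tauP).
  by apply: (eq_tlift (W := k^o)) => u1 u2; rewrite mulrC.
Qed.

Lemma tauV_mull u u' a : tauV ((u * u') \ox a) =
  tlift (fun a1 a2 => tauV (u \ox a2) * tauV (u' \ox a1) : k^o) (comul a).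
Proof.
apply: (@pairing_inverse_mul k A U *%R
  (fun a u => tau (u \ox a)) (fun a u => tauV (u \ox a))).
- by lin.
- by lin.
- by lin.
- by move=> W F b c bF; rewrite tlift_comulM.
- exact: counitM.
- by move=> c b; rewrite exchange_tlift tau_tauV mulrC.
- by move=> c b; rewrite exchange_tlift tauV_tau mulrC.
- by move=> c b b'; rewrite (skew_mull tauP).
Qed.

End SkewPairing.

(** * The module [U_chi] *)

Section Sweedler5.
Variables (k : fieldType) (C : coalgType k) (W : lmodType k).

Lemma sweedler3_comp (W' : lmodType k) (h : W -> W') (f : C -> C -> C -> W) c :
  linear h -> h (sweedler3 f c) = sweedler3 (fun x y z => h (f x y z)) c.
Proof.
move=> lh; rewrite /sweedler3 (tlift_comp _ lh).
by apply: eq_tlift => x y; rewrite (tlift_comp _ lh).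
Qed.

Lemma eq_sweedler3 (f g : C -> C -> C -> W) c :
  (forall x y z, f x y z = g x y z) -> sweedler3 f c = sweedler3 g c.
Proof. by move=> fg; apply: eq_tlift => x y; apply: eq_tlift. Qed.

(** Both sides feed the five consecutive legs of [c] to [f]; only the bracketing of the iterated
    comultiplication differs. The right side nests one triple of legs inside the middle leg of
    another. *)
Lemma sweedler5_mid (f : C -> C -> C -> C -> C -> W) c :
  (forall y z t s, linear (fun x => f x y z t s)) ->
  (forall x z t s, linear (fun y => f x y z t s)) ->
  (forall x y t s, linear (fun z => f x y z t s)) ->
  (forall x y z s, linear (fun t => f x y z t s)) ->
  (forall x y z t, linear (fun s => f x y z t s)) ->
  sweedler3 (fun x y z => tlift (fun x1 x2 => tlift (fun z1 z2 =>
    f x1 x2 y z1 z2) (comul z)) (comul x)) c =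
  sweedler3 (fun x y z => sweedler3 (fun y1 y2 y3 => f x y1 y2 y3 z) y) c.
Proof.
move=> f1 f2 f3 f4 f5.
transitivity (tlift (fun x r => tlift (fun x1 x2 => tlift (fun y z =>
    tlift (fun z1 z2 => f x1 x2 y z1 z2) (comul z)) (comul r)) (comul x)) (comul c)).
  apply: eq_tlift => x r; rewrite exchange_tlift.
  by apply: eq_tlift => x1 x2; apply: eq_tlift.
rewrite (sweedlerA (f := fun x1 x2 r => tlift (fun y z =>
    tlift (fun z1 z2 => f x1 x2 y z1 z2) (comul z)) (comul r))); [|by lin..].
apply: eq_tlift => x s.
transitivity (tlift (fun x2 r => tlift (fun w z2 => tlift (fun y z1 =>
    f x x2 y z1 z2) (comul w)) (comul r)) (comul s)).
  by apply: eq_tlift => x2 r; rewrite sweedlerA.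
rewrite -[LHS](sweedlerA (f := fun x2 w z2 => tlift (fun y z1 =>
    f x x2 y z1 z2) (comul w))) //; by lin.
Qed.

End Sweedler5.

Lemma exchange_sweedler3 (k : fieldType) (C D : coalgType k) (W : lmodType k)
    (f : C -> C -> C -> D -> D -> D -> W) c d :
  sweedler3 (fun x y z => sweedler3 (f x y z) d) c =
  sweedler3 (fun x' y' z' => sweedler3 (fun x y z => f x y z x' y' z') c) d.
Proof.
rewrite /sweedler3.
under eq_tlift do (rewrite exchange_tlift; under eq_tlift do rewrite exchange_tlift).
rewrite exchange_tlift; apply: eq_tlift => x' y'.
by rewrite exchange_tlift.
Qed.

Lemma sweedler3M (k : fieldType) (B : bialgType k) (W : lmodType k)
    (f : B -> B -> B -> W) b c :
  (forall y z, linear (fun x => f x y z)) ->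
  (forall x z, linear (fun y => f x y z)) ->
  (forall x y, linear (fun z => f x y z)) ->
  sweedler3 f (b * c) = sweedler3 (fun b1 b2 b3 =>
    sweedler3 (fun c1 c2 c3 => f (b1 * c1) (b2 * c2) (b3 * c3)) c) b.
Proof.
move=> f1 f2 f3; rewrite /sweedler3 tlift_comulM; last by lin.
apply: eq_tlift => b1 b'; rewrite [RHS]exchange_tlift.
by apply: eq_tlift => c1 c'; rewrite tlift_comulM //; lin.
Qed.

Section Uchi.
Variables (k : fieldType) (U A : bialgType k) (tau tauV : {scalar tensor U A}).
Hypotheses (tauP : skew_pairing tau)
  (tauVP : conv_inverse (C := tensor U A) tau tauV).
Variable chi : Alg A.
Implicit Types (u v : U) (a : A).

Let tlU f := @tlift_scalel k U U f U.
Let tlA f := @tlift_scalel k A A f U.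

(** The hit actions on [U] of two functionals of its dual algebra: [tau(-, a)] contracts the first
    leg, hence acts from the right, and [tauV(-, a)] contracts the last leg, hence acts from the
    left. *)
Definition lhit a u : U := tlift (fun u1 u2 => tau (u1 \ox a) *: u2) (comul u).
Definition rhit a u : U := tlift (fun u1 u2 => tauV (u2 \ox a) *: u1) (comul u).

Lemma lhit_linl u : linear (lhit^~ u). Proof. by rewrite /lhit; lin. Qed.
Lemma lhit_linr a : linear (lhit a). Proof. by rewrite /lhit; lin. Qed.
Lemma rhit_linl u : linear (rhit^~ u). Proof. by rewrite /rhit; lin. Qed.
Lemma rhit_linr a : linear (rhit a). Proof. by rewrite /rhit; lin. Qed.

Lemma lhit_rhit a b u : lhit a (rhit b u) =
  sweedler3 (fun u1 u2 u3 => (tau (u1 \ox a) * tauV (u3 \ox b)) *: u2) u.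
Proof.
rewrite /rhit (tlift_comp _ (lhit_linr a)) -sweedlerA; [|by lin..].
apply: eq_tlift => u1 u3; rewrite (linearZP _ (lhit_linr a)) /lhit tlift_scaler.
by apply: eq_tlift => x y; rewrite scalerA mulrC.
Qed.

Lemma rhit_lhit a b u : rhit b (lhit a u) = lhit a (rhit b u).
Proof.
rewrite lhit_rhit /lhit (tlift_comp _ (rhit_linr b)).
apply: eq_tlift => u1 u2; rewrite (linearZP _ (rhit_linr b)) /rhit tlift_scaler.
by apply: eq_tlift => x y; rewrite scalerA.
Qed.

(** By [skew_mulr] the map [a |-> tau(-, a)] reverses products, and these functionals hit from the
    right; the two reversals cancel. In [rhitM] no reversal occurs at all. *)
Lemma lhitM a b u : lhit (a * b) u = lhit a (lhit b u).
Proof.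
rewrite {3}/lhit (tlift_comp _ (lhit_linr a)).
transitivity (sweedler3 (fun x y z => tau (x \ox b) *: (tau (y \ox a) *: z)) u).
  rewrite -sweedlerA; [|by lin..].
  apply: eq_tlift => x y; rewrite (skew_mulr tauP) tlU.
  by apply: eq_tlift => x1 x2; rewrite scalerA mulrC.
by apply: eq_tlift => x y; rewrite (linearZP _ (lhit_linr a)) tlift_scaler.
Qed.

Lemma rhitM a b u : rhit (a * b) u = rhit a (rhit b u).
Proof.
rewrite {3}/rhit (tlift_comp _ (rhit_linr a)).
transitivity (sweedler3 (fun x y z => tauV (z \ox b) *: (tauV (y \ox a) *: x)) u).
  apply: eq_tlift => x y; rewrite (tauV_mulr tauP tauVP) tlU.
  by apply: eq_tlift => x1 x2; rewrite scalerA mulrC.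
rewrite -sweedlerA; [|by lin..].
by apply: eq_tlift => x y; rewrite (linearZP _ (rhit_linr a)) tlift_scaler.
Qed.

Lemma lhit1 u : lhit 1 u = u.
Proof.
rewrite -[RHS](counit_comull u); apply: eq_tlift => x y.
by rewrite (skew_1r tauP).
Qed.

Lemma rhit1 u : rhit 1 u = u.
Proof.
rewrite -[RHS](counit_comulr u); apply: eq_tlift => x y.
by rewrite (tauV_1r tauP tauVP).
Qed.

Lemma lhit_mul a u v :
  lhit a (u * v) = tlift (fun a1 a2 => lhit a1 u * lhit a2 v) (comul a).
Proof.
rewrite {1}/lhit tlift_comulM; last by lin.
transitivity (tlift (fun u1 u2 => tlift (fun v1 v2 => tlift (fun a1 a2 =>
    (tau (u1 \ox a1) * tau (v1 \ox a2)) *: (u2 * v2)) (comul a)) (comul v)) (comul u)).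
  apply: eq_tlift => u1 u2; apply: eq_tlift => v1 v2.
  by rewrite (skew_mull tauP) tlA.
under eq_tlift do rewrite exchange_tlift.
rewrite exchange_tlift; apply: eq_tlift => a1 a2.
rewrite {2}/lhit (tlift_comp (h := fun w => w * _)); last by lin.
apply: eq_tlift => u1 u2.
rewrite /lhit (tlift_comp (h := fun w => _ * w)); last by lin.
by apply: eq_tlift => v1 v2; rewrite -scalerAl -scalerAr scalerA.
Qed.

(** Compared with [lhit_mul] the legs of [a] are reversed, as [tauV] is an inverse. Consequently,
    when both hits are applied to [u * v], the legs hitting [u] enclose those hitting [v]. *)
Lemma rhit_mul a u v :
  rhit a (u * v) = tlift (fun a1 a2 => rhit a2 u * rhit a1 v) (comul a).
Proof.
rewrite {1}/rhit tlift_comulM; last by lin.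
transitivity (tlift (fun u1 u2 => tlift (fun v1 v2 => tlift (fun a1 a2 =>
    (tauV (u2 \ox a2) * tauV (v2 \ox a1)) *: (u1 * v1)) (comul a)) (comul v)) (comul u)).
  apply: eq_tlift => u1 u2; apply: eq_tlift => v1 v2.
  by rewrite (tauV_mull tauP tauVP) tlA.
under eq_tlift do rewrite exchange_tlift.
rewrite exchange_tlift; apply: eq_tlift => a1 a2.
rewrite {2}/rhit (tlift_comp (h := fun w => w * _)); last by lin.
apply: eq_tlift => u1 u2.
rewrite /rhit (tlift_comp (h := fun w => _ * w)); last by lin.
by apply: eq_tlift => v1 v2; rewrite -scalerAl -scalerAr scalerA.
Qed.

(** The two hit actions of [A] on [U] commute, and both are multiplicative in
    [A]; hence so is their combination twisted by the character [chi]. *)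
Definition chi_act a u : U :=
  sweedler3 (fun a1 a2 a3 => chi a2 *: lhit a1 (rhit a3 u)) a.

Let l1 := lhit_linl.
Let l2 := lhit_linr.
Let r1 := rhit_linl.
Let r2 := rhit_linr.
Let lchi := lin_Alg chi.

Lemma chi_actE a u :
  id_chi chi (twist_mul tau tauV (1 \ox a) (u \ox 1)) = chi_act a u.
Proof.
have li := @id_chi_linear k U A chi.
rewrite twist_mul_tens /twist_pure (sweedler3_comp _ _ li).
transitivity (sweedler3 (fun u1 u2 u3 => sweedler3 (fun a1 a2 a3 =>
   chi a2 *: ((tau (u1 \ox a1) * tauV (u3 \ox a3)) *: u2)) a) u).
  apply: eq_sweedler3 => u1 u2 u3; rewrite (sweedler3_comp _ _ li).
  apply: eq_sweedler3 => a1 a2 a3.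
  by rewrite (linearZP _ li) id_chi_tens mul1r mulr1 !scalerA mulrC.
rewrite exchange_sweedler3; apply: eq_sweedler3 => a1 a2 a3.
rewrite lhit_rhit (sweedler3_comp (h := fun w => _ *: w)) //.
by lin.
Qed.

Lemma chi_act_linl u : linear (chi_act^~ u).
Proof. by apply: sweedler3_linear => x y; lin. Qed.

Lemma chi_act_linr a : linear (chi_act a).
Proof. by apply: linear_sweedler3 => x y z; lin. Qed.

Lemma chi_act1 u : chi_act 1 u = u.
Proof.
rewrite /chi_act sweedler3_1; [|by lin..].
by rewrite rmorph1 scale1r rhit1 lhit1.
Qed.

Lemma chi_actM a b u : chi_act (a * b) u = chi_act a (chi_act b u).
Proof.
rewrite {1}/chi_act sweedler3M; [|by lin..].
apply: eq_sweedler3 => a1 a2 a3.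
rewrite /chi_act (sweedler3_comp (h := fun w => _ *: lhit _ (rhit _ w))); last by lin.
apply: eq_sweedler3 => b1 b2 b3.
rewrite rmorphM lhitM rhitM -scalerA (linearZP _ (r2 _)) (linearZP _ (l2 _)).
by rewrite rhit_lhit.
Qed.

(** The commutation rule of [H] realized on [U_chi]: moving [a] past [u] costs [tau] on the outer
    left legs and [tauV] on the outer right ones. This is what [Uact_module] needs in order to
    compare the action of a product with two successive actions. *)
Lemma chi_act_mul a u v : chi_act a (u * v) =
  sweedler3 (fun u1 u2 u3 => sweedler3 (fun a1 a2 a3 =>
    (tau (u1 \ox a1) * tauV (u3 \ox a3)) *: (u2 * chi_act a2 v)) a) u.
Proof.
have c1 := chi_act_linl.
transitivity (sweedler3 (fun a1 a2 a3 =>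
    lhit a1 (rhit a3 u) * chi_act a2 v) a); last first.
  rewrite exchange_sweedler3; apply: eq_sweedler3 => a1 a2 a3.
  rewrite lhit_rhit (sweedler3_comp (h := fun w => w * _)); last by lin.
  by apply: eq_sweedler3 => u1 u2 u3; rewrite scalerAl.
transitivity (sweedler3 (fun a1 a2 a3 => sweedler3 (fun b1 b2 b3 =>
    chi b2 *: (lhit a1 (rhit a3 u) * lhit b1 (rhit b3 v))) a2) a); last first.
  apply: eq_sweedler3 => a1 a2 a3.
  rewrite /chi_act (sweedler3_comp (h := fun w => _ * w)); last by lin.
  by apply: eq_sweedler3 => b1 b2 b3; rewrite scalerAr.
(* Of the five legs of [a], the outermost two hit [u], the next two hit [v], and the central one is
   evaluated by [chi]. *)
rewrite -(sweedler5_mid (f := fun x y z t s =>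
  chi z *: (lhit x (rhit s u) * lhit y (rhit t v)))); [|by lin..].
apply: eq_sweedler3 => a1 a2 a3.
rewrite rhit_mul (tlift_comp (h := fun w => _ *: lhit _ w)); last by lin.
rewrite [RHS]exchange_tlift; apply: eq_tlift => b1 b2.
by rewrite lhit_mul tlift_scaler.
Qed.

Lemma Uact_tens_chi u a v : Uact tau tauV chi (u \ox a) v = u * chi_act a v.
Proof. by rewrite Uact_tens chi_actE. Qed.

Lemma Uact_linl v : linear (fun h => Uact tau tauV chi h v).
Proof.
apply: tlift_linear; split=> [a|u] c x y; first by rewrite mulrDl scalerAl.
by rewrite !chi_actE chi_act_linl mulrDr scalerAr.
Qed.

Lemma Uact_module :
  is_module (twist_mul tau tauV) (twist_one U A) (Uact tau tauV chi).
Proof.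
have c1 := chi_act_linl; have c2 := chi_act_linr.
have ul := Uact_linl; have ur h := Uact_linearr tau tauV chi h.
have tl := @twist_mul_linearl _ _ _ tau tauV.
have tr := @twist_mul_linearr _ _ _ tau tauV.
split=> // [v|h h' v]; first by rewrite Uact_tens_chi chi_act1 mul1r.
move: h; apply: tensor_linear_eq => [||u a].
- by apply: (linear_compl (f := fun h => Uact tau tauV chi h v)).
- exact: ul.
move: h'; apply: tensor_linear_eq => [||u' a'].
- by apply: (linear_compl (f := fun h => Uact tau tauV chi h v)).
- by apply: (linear_compl (g := fun h => Uact tau tauV chi h v)).
rewrite twist_mul_tens !Uact_tens_chi chi_act_mul /twist_pure.
rewrite (sweedler3_comp (h := fun h => Uact tau tauV chi h v)) //.
rewrite [RHS](sweedler3_comp (h := fun w => u * w)); last by lin.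
apply: eq_sweedler3 => u1 u2 u3.
rewrite (sweedler3_comp (h := fun h => Uact tau tauV chi h v)) //.
rewrite [RHS](sweedler3_comp (h := fun w => u * w)); last by lin.
apply: eq_sweedler3 => a1 a2 a3.
by rewrite (linearZP _ (ul v)) Uact_tens_chi chi_actM -scalerAr mulrA.
Qed.

End Uchi.

(** * Eigenvectors and invariant hyperplanes *)

Section Characters.
Variables (k : fieldType) (B : bialgType k) (M : lmodType k) (act : B -> M -> M).
Hypothesis actP : is_module *%R 1 act.

Lemma line_char (m : M) : m <> 0 -> is_submodule act (line m) ->
  exists chi : Alg B, forall b, act b m = chi b *: m.
Proof.
move=> m0 sub_m.
have line_m b : exists c : k, act b m = c *: m.
  by apply: (submod_act sub_m); exists 1; rewrite scale1r.
pose chi b : k := projT1 (cid (line_m b)).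
have chiE b : act b m = chi b *: m by rewrite /chi; case: cid.
have m_inj (c d : k) : c *: m = d *: m -> c = d.
  move/eqP; rewrite -subr_eq0 -scalerBl scaler_eq0 subr_eq0.
  by move=> /orP[/eqP//|/eqP].
have [||g gE] := @AlgP k B chi.
- move=> c x y; apply: m_inj.
  by rewrite -chiE (act_linearl actP) !chiE scalerA -scalerDl.
- split=> [|x y]; apply: m_inj; first by rewrite -chiE (act_one actP) scale1r.
  rewrite -chiE (act_mul actP) chiE (linearZP _ (act_linearr actP x)) chiE.
  by rewrite scalerA mulrC.
by exists g => b; rewrite gE.
Qed.

Lemma char_line (m : M) (chi : B -> k) :
  (forall b, act b m = chi b *: m) -> is_submodule act (line m).
Proof.
move=> chiE; split=> [|x y [c ->] [d ->]|c x [d ->]|b x [d ->]].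
- by exists 0; rewrite scale0r.
- by exists (c + d); rewrite scalerDl.
- by exists (c * d); rewrite scalerA.
- by exists (d * chi b); rewrite (linearZP _ (act_linearr actP b)) chiE scalerA.
Qed.

(** The quotient by [N] is a one-dimensional module: [pi] is the coordinate with respect to the
    class of [m], and [rho] is the character by which [B] acts there. *)
Lemma codim1_char (N : set M) : is_submodule act N -> codim1 N ->
  exists (pi : M -> k) (rho : Alg B),
    [/\ linear (pi : M -> k^o), exists m, pi m = 1,
        forall x, N x <-> pi x = 0 & forall b x, pi (act b x) = rho b * pi x].
Proof.
move=> subN [m Nm mod_m].
pose pi x : k := projT1 (cid (mod_m x)).
have piE x : N (x - pi x *: m) by rewrite /pi; case: cid.
have NB x y : N x -> N y -> N (x - y).
  move=> Nx Ny; apply: (submodD subN) => //.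
  by rewrite -scaleN1r; apply: (submodZ subN).
have pi_uniq x c : N (x - c *: m) -> pi x = c.
  (* Otherwise the difference of the two decompositions of [x] is a nonzero multiple of [m] in
     [N]. *)
  move=> Nc; apply/eqP; rewrite -subr_eq0; apply: contrapT => /negP d0.
  apply: Nm; rewrite -[m]scale1r -(mulVf d0) -scalerA; apply: (submodZ subN).
  rewrite scalerBl.
  have -> : pi x *: m - c *: m = (x - c *: m) - (x - pi x *: m).
    by rewrite opprB [RHS]addrC addrA subrK.
  exact: NB.
have lpi : linear (pi : M -> k^o).
  move=> c x y; apply: pi_uniq.
  have -> : c *: x + y - (c *: (pi x : k^o) + pi y) *: m =
            c *: (x - pi x *: m) + (y - pi y *: m).
    by rewrite scalerDl scalerBr !scalerA opprD !addrA [_ - _ + y]addrAC.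
  by apply: (submodD subN) => //; apply: (submodZ subN).
have pi0 x : N x <-> pi x = 0.
  split=> [Nx|p0]; first by apply: pi_uniq; rewrite scale0r subr0.
  by have := piE x; rewrite p0 scale0r subr0.
have pim : pi m = 1.
  by apply: pi_uniq; rewrite scale1r subrr; apply: (submod0 subN).
have piM b x : pi (act b x) = pi (act b m) * pi x.
  have := submod_act subN b (piE x).
  rewrite -scaleN1r addrC (act_linearr actP) (linearZP _ (act_linearr actP b)).
  move=> /pi0; rewrite lpi (linearZP _ lpi) scaleN1r addrC => /eqP.
  by rewrite subr_eq0 => /eqP ->; rewrite -[LHS]/(_ * _) mulrC.
have [||rho rhoE] := @AlgP k B (fun b => pi (act b m)).
- by move=> c x y; rewrite (act_linearl actP) lpi.
- split=> [|x y]; first by rewrite (act_one actP).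
  by rewrite (act_mul actP) piM.
exists pi, rho; split=> // [|b x]; first by exists m.
by rewrite rhoE piM.
Qed.

Lemma char_codim1 (pi : M -> k) (rho : B -> k) m : linear (pi : M -> k^o) ->
  pi m = 1 -> (forall b x, pi (act b x) = rho b * pi x) ->
  is_submodule act [set x | pi x = 0] /\ codim1 [set x | pi x = 0].
Proof.
move=> lpi pim piM; split; last first.
  exists m => [/= p0|x]; first by move/eqP: pim; rewrite p0 eq_sym oner_eq0.
  exists (pi x); rewrite /= -scaleN1r addrC lpi (linearZP _ lpi) pim.
  by rewrite -[_ *: 1]/(_ * 1) mulr1 scaleN1r addNr.
split=> [|x y /= x0 y0|c x /= x0|b x /= x0].
- exact: (linear0P lpi).
- by rewrite (linearDP lpi) x0 y0 addr0.
- by rewrite (linearZP _ lpi) x0 scaler0.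
- by rewrite piM x0 mulr0.
Qed.

End Characters.

(** Commutativity is applied to the two characters [f] and [h]; then [fV], given merely as a linear
    functional, cancels against [f]. *)
Lemma alg_conj (k : fieldType) (B : bialgType k) (f h : Alg B) (fV : B -> k^o) :
  determined_by_grouplikes B -> linear fV -> conv f fV =1 counit ->
  conv f (conv h fV) =1 h.
Proof.
move=> detB lV ffV b.
have lf := lin_Alg f; have lh := lin_Alg h.
rewrite -convA //.
have E : conv f h =1 conv h f.
  by move=> c; have /(congr1 (fun g : Alg B => g c)) := alg_mulC detB f h.
rewrite (eq_conv E (fun=> erefl)) convA // (eq_conv (fun=> erefl) ffV).
by rewrite conv1r.
Qed.

Section SkewGrouplike.
Variables (k : fieldType) (U A : bialgType k) (tau tauV : {scalar tensor U A}).
Hypotheses (tauP : skew_pairing tau)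
  (tauVP : conv_inverse (C := tensor U A) tau tauV).
Hypotheses (detU : determined_by_grouplikes U)
  (detA : determined_by_grouplikes A).
Variables (rho : Alg U) (chi : Alg A).
Local Notation chi_act := (chi_act tau tauV chi).

(** All three legs of [x] equal [x], so [chi x] factors out and a conjugate of [rho] in the dual
    algebra of [U] remains. *)
Lemma rho_chi_act (x : A) u : grouplike x -> rho (chi_act x u) = chi x * rho u.
Proof.
move=> gx; have lr := lin_Alg rho.
have l1 := @lhit_linl k U A tau; have l2 := @lhit_linr k U A tau.
have r1 := @rhit_linl k U A tauV; have r2 := @rhit_linr k U A tauV.
have lchi := lin_Alg chi.
have [||t tE] := @AlgP k U (fun u => tau (u \ox x)).
- by move=> c y z; rewrite tens_linl linearP.
- split=> [|u1 u2]; first by rewrite (skew_1l tauP) gx.2.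
  by rewrite (skew_mull tauP) (tlift_grouplike (W := k^o)) //; lin.
rewrite /chi_act /sweedler3 tlift_grouplike //; last by lin.
rewrite tlift_grouplike //; last by lin.
rewrite (linearZP _ lr) lhit_rhit -[LHS]/(@GRing.mul k _ _); congr (_ * _).
pose tV (u : U) : k^o := tauV (u \ox x).
have ltV : linear tV by rewrite /tV; lin.
rewrite -[RHS](alg_conj (f := t) (fV := tV) rho detU ltV); last first.
  move=> v; have := tau_tauV tauVP v x; rewrite gx.2 mulr1 => <-.
  apply: (eq_tlift (W := k^o)) => v1 v2.
  by rewrite tlift_grouplike // ?tE //; lin.
rewrite (sweedler3_comp (W' := k^o) (h := rho)) // /conv.
apply: (eq_tlift (W := k^o)) => u1 u'; rewrite tliftMl.
apply: (eq_tlift (W := k^o)) => u2 u3; rewrite (linearZP _ lr) tE.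
by rewrite -[LHS]/(_ * _) mulrAC -mulrA.
Qed.

(** The mirror image of [rho_chi_act]: here the legs of [g] are all [g], and [chi] is conjugated by
    the character [tau(g, -)] of [A]. *)
Lemma chi_act_grouplike a (g : U) : grouplike g -> chi_act a g = chi a *: g.
Proof.
move=> gg; have lchi := lin_Alg chi.
have [||s sE] := @AlgP k A (fun a => tau (g \ox a)).
- by move=> c y z; rewrite tens_linr linearP.
- split=> [|a1 a2]; first by rewrite (skew_1r tauP) gg.2.
  by rewrite (skew_mulr tauP) (tlift_grouplike (W := k^o)) //; lin.
pose sV (a : A) : k^o := tauV (g \ox a).
have lsV : linear sV by rewrite /sV; lin.
rewrite -[chi a](alg_conj (f := s) (fV := sV) chi detA lsV); last first.
  move=> v; have := tau_tauV tauVP g v; rewrite gg.2 mul1r => <-.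
  rewrite tlift_grouplike //; last by lin.
  by apply: (eq_tlift (W := k^o)) => v1 v2; rewrite sE.
rewrite /conv (@tlift_scalel k A A _ U).
apply: eq_tlift => a1 a'; rewrite tliftMl (@tlift_scalel k A A _ U).
apply: eq_tlift => a2 a3; rewrite lhit_rhit /sweedler3 tlift_grouplike //; last by lin.
rewrite tlift_grouplike //; last by lin.
by rewrite sE scalerA mulrCA mulrA.
Qed.

End SkewGrouplike.

(** * Modules over the twisted algebra [H] and their eigenvectors *)

Section TwistedModules.
Variables (k : fieldType) (U A : bialgType k) (tau tauV : {scalar tensor U A}).
Hypotheses (tauP : skew_pairing tau)
  (tauVP : conv_inverse (C := tensor U A) tau tauV).
Local Notation H := (tensor U A).
Local Notation Hmul := (twist_mul tau tauV).

Lemma sweedler3_counit (C : coalgType k) (W : lmodType k) (f : C -> W) c :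
  linear f -> sweedler3 (fun x y z => (counit x * counit z) *: f y) c = f c.
Proof.
move=> lf; rewrite /sweedler3 -[RHS](counitl c lf).
apply: eq_tlift => x r; rewrite -[f r](counitr r lf) tlift_scaler.
by apply: eq_tlift => y z; rewrite scalerA.
Qed.

Lemma twist_mul_1l u a a' : Hmul (u \ox a) (1 \ox a') = u \ox (a * a').
Proof.
rewrite twist_mul_tens /twist_pure sweedler3_1; first last.
- by move=> x y; apply: linear_sweedler3 => *; lin.
- by move=> x y; apply: linear_sweedler3 => *; lin.
- by move=> x y; apply: linear_sweedler3 => *; lin.
rewrite -(sweedler3_counit (f := fun a => u \ox (a * a'))); last by lin.
apply: eq_sweedler3 => a1 a2 a3.
by rewrite (skew_1l tauP) (tauV_1l tauP tauVP) mulr1.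
Qed.

Lemma twist_mul_1r u u' a' : Hmul (u \ox 1) (u' \ox a') = (u * u') \ox a'.
Proof.
rewrite twist_mul_tens /twist_pure.
rewrite -(sweedler3_counit (f := fun u' => (u * u') \ox a')); last by lin.
apply: eq_sweedler3 => u1 u2 u3; rewrite sweedler3_1; [|by lin..].
by rewrite (skew_1r tauP) (tauV_1r tauP tauVP) mul1r.
Qed.

Lemma chi_act_1r (chi : Alg A) a : chi_act tau tauV chi a 1 = chi a *: 1.
Proof.
have lc := lin_Alg chi.
rewrite -(sweedler3_counit (f := fun a => chi a *: 1)); last by lin.
have r1 b : rhit tauV b 1 = counit b *: 1.
  by rewrite /rhit tlift_comul1 ?(tauV_1l tauP tauVP) //; lin.
have l1 b : lhit tau b 1 = counit b *: 1.
  by rewrite /lhit tlift_comul1 ?(skew_1l tauP) //; lin.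
apply: eq_sweedler3 => a1 a2 a3.
by rewrite r1 (linearZP _ (lhit_linr _ _)) l1 !scalerA mulrC [chi a2 * _]mulrC mulrA.
Qed.

(** Exhibits [U_chi] as the module induced from the character [chi] of [A]: multiply on the left in
    [H], then evaluate the [A]-factor by [chi]. *)
Lemma Uact_id_chi chi h u : Uact tau tauV chi h u = id_chi chi (Hmul h (u \ox 1)).
Proof.
have li := @id_chi_linear k U A chi.
have ll := @twist_mul_linearl k U A tau tauV.
move: h; apply: tensor_linear_eq => [||v a].
- exact: Uact_linl.
- by apply: (linear_compl (f := id_chi chi) (g := Hmul^~ _)).
rewrite Uact_tens !twist_mul_tens /twist_pure !(sweedler3_comp _ _ li).
rewrite (sweedler3_comp (h := fun w => v * w)); last by lin.
apply: eq_sweedler3 => u1 u2 u3; rewrite !(sweedler3_comp _ _ li).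
rewrite (sweedler3_comp (h := fun w => v * w)); last by lin.
apply: eq_sweedler3 => a1 a2 a3.
by rewrite !(linearZP _ li) !id_chi_tens mul1r -!scalerAr.
Qed.

Section OneModule.
Variables (M : lmodType k) (act : H -> M -> M).
Hypothesis actP : is_module Hmul (twist_one U A) act.
Let actl := act_linearl actP.
Let actr := act_linearr actP.

Lemma act_tens u a m : act (u \ox a) m = act (u \ox 1) (act (1 \ox a) m).
Proof. by rewrite -(act_mul actP) twist_mul_1l mul1r. Qed.

Lemma resU_module : is_module *%R 1 (resU act).
Proof.
split=> [m|u|m|u u' m]; rewrite /resU; [by lin | exact: actr | |].
  exact: (act_one actP).
by rewrite -(act_mul actP) twist_mul_1r.
Qed.

Lemma resA_module : is_module *%R 1 (resA act).
Proof.
split=> [m|a|m|a a' m]; rewrite /resA; [by lin | exact: actr | |].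
  exact: (act_one actP).
by rewrite -(act_mul actP) twist_mul_1l.
Qed.

(** The universal property of the induced module: any [t] in [H] acts on the eigenvector [m] as
    [id_chi chi t] does, so [u |-> u m] is [H]-linear on [U_chi]. *)
Lemma Uact_eigen (chi : Alg A) m : (forall a, resA act a m = chi a *: m) ->
  forall h u, act h (act (u \ox 1) m) = act (Uact tau tauV chi h u \ox 1) m.
Proof.
move=> chiE h u; rewrite -(act_mul actP) Uact_id_chi; move: (Hmul _ _).
have li := @id_chi_linear k U A chi.
apply: tensor_linear_eq => [||v a]; [exact: actl | by lin |].
rewrite act_tens -[act (1 \ox a) m]/(resA act a m) chiE (linearZP _ (actr _)).
by rewrite id_chi_tens tensZl (linearZP _ (actl _)).
Qed.

(** This set is the image of the [H]-linear map of [Uact_eigen]; so an [A]-eigenvector generates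
    over [H] nothing beyond its [U]-orbit. *)
Lemma orbit_submodule (chi : Alg A) m : (forall a, resA act a m = chi a *: m) ->
  is_submodule act [set v | exists u, v = act (u \ox 1) m].
Proof.
move=> chiE; have lo : linear (fun u => act (u \ox 1) m) by lin.
split=> [|x y [u ->] [u' ->]|c x [u ->]|h x [u ->]].
- by exists 0; rewrite (linear0P lo).
- by exists (u + u'); rewrite (linearDP lo).
- by exists (c *: u); rewrite (linearZP _ lo).
- by eexists; apply: (Uact_eigen chiE).
Qed.

(** The category in terms of eigenvectors and eigenfunctionals. Generation is stated over [U], which
    for an [A]-eigenvector amounts to generation over [H] by [orbit_submodule]. *)
Record HM_data (m : M) (chi : Alg A) (pi : M -> k) (rho : Alg U) : Prop := {
  data_chi : forall a, resA act a m = chi a *: m;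
  data_gen : forall v, exists u, v = act (u \ox 1) m;
  data_lin : linear (pi : M -> k^o);
  data_pi : pi m = 1;
  data_rho : forall u v, pi (resU act u v) = rho u * pi v;
  data_cog : forall P, is_submodule act P -> (forall x, P x -> pi x = 0) ->
    forall x, P x -> x = 0
}.

Lemma in_HM_data : in_HM tau tauV act -> exists m chi pi rho, HM_data m chi pi rho.
Proof.
move=> [_ [m [m0 line_m gen_m]] [N [subN codimN cogN]]].
have [chi chiE] := line_char resA_module m0 line_m.
have [pi [rho [lpi _ NE rhoE]]] := codim1_char resU_module subN codimN.
have gen v : exists u, v = act (u \ox 1) m.
  change ([set v | exists u, v = act (u \ox 1) m] v).
  rewrite (gen_m _ (orbit_submodule chiE)) //.
  by exists 1; rewrite (act_one actP).
have cog P : is_submodule act P -> (forall x, P x -> pi x = 0) ->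
    forall x, P x -> x = 0.
  move=> subP P0 x; rewrite (cogN P subP) // => y /P0; exact: (NE y).2.
(* If [pi m] were zero, the kernel of [pi] would contain the nonzero submodule generated by [m].
   Hence [pi] can be rescaled to take the value [1] at [m]. *)
have pim0 : pi m != 0.
  apply/eqP => pm; apply: m0; apply: (cog _ (orbit_submodule chiE)).
    by move=> x [u ->]; rewrite -[act _ _]/(resU act u m) rhoE pm mulr0.
  by exists 1; rewrite (act_one actP).
have lZ : linear (fun x => (pi m)^-1 * pi x : k^o) by lin.
exists m, chi, (fun x => (pi m)^-1 * pi x), rho; split=> //.
- by rewrite mulVf.
- by move=> u v; rewrite rhoE mulrCA.
- move=> P subP P0; apply: cog => // x /P0/eqP.
  by rewrite mulf_eq0 invr_eq0 (negPf pim0) => /eqP.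
Qed.

Lemma data_in_HM m chi pi rho : HM_data m chi pi rho -> in_HM tau tauV act.
Proof.
move=> d; split=> //.
  exists m; split.
  - by move=> m0; have/eqP := data_pi d; rewrite m0 (linear0P (data_lin d)) eq_sym oner_eq0.
  - exact: (char_line resA_module (data_chi d)).
  - move=> N subN Nm; rewrite predeqE => v; split=> // _.
    by have [u ->] := data_gen d v; apply: (submod_act subN).
have [sub1 cod1] := char_codim1 (data_lin d) (data_pi d) (data_rho d).
exists [set x | pi x = 0]; split=> // P subP PN.
rewrite predeqE => x; split=> [|->]; last exact: (submod0 subP).
by apply: (data_cog d subP) => y /PN.
Qed.

Hypotheses (detU : determined_by_grouplikes U)
  (detA : determined_by_grouplikes A).

Section Uniqueness.
Variables (m : M) (chi : Alg A) (pi : M -> k) (rho : Alg U).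
Hypothesis d : HM_data m chi pi rho.

Lemma data_pi_act u : pi (act (u \ox 1) m) = rho u.
Proof. by have := data_rho d u m; rewrite (data_pi d) mulr1. Qed.

(** Along the surjection [u |-> u m] from [U_chi], the functional [pi] pulls back to [rho], so this
    is [rho_chi_act]. *)
Lemma pi_grouplike (x : A) v : grouplike x -> pi (resA act x v) = chi x * pi v.
Proof.
move=> gx; have [u ->] := data_gen d v.
rewrite /resA (Uact_eigen (data_chi d)) Uact_tens_chi mul1r !data_pi_act.
exact: rho_chi_act.
Qed.

(** The [U]-orbit of [m'] is an [H]-submodule, and it stays in the kernel since [U] acts on [pi] by
    the scalars [rho u]. *)
Lemma eigen_ker m' (chi' : Alg A) :
  (forall a, resA act a m' = chi' a *: m') -> pi m' = 0 -> m' = 0.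
Proof.
move=> chiE pm; apply: (data_cog d (orbit_submodule chiE)).
  by move=> x [u ->]; rewrite -[act _ _]/(resU act u m') (data_rho d) pm mulr0.
by exists 1; rewrite (act_one actP).
Qed.

Lemma eigen_char m' (chi' : Alg A) : m' <> 0 ->
  (forall a, resA act a m' = chi' a *: m') -> chi' = chi.
Proof.
move=> m0 chiE; apply: detA => x gx.
have pm0 : pi m' != 0 by apply/eqP => /(eigen_ker chiE).
apply: (mulIf pm0); rewrite -pi_grouplike // chiE.
by rewrite (linearZP _ (data_lin d)).
Qed.

(** The difference of the two sides is an eigenvector killed by [pi], so [eigen_ker] applies. *)
Lemma eigen_line m' : (forall a, resA act a m' = chi a *: m') -> m' = pi m' *: m.
Proof.
move=> chiE; apply/eqP; rewrite -subr_eq0; apply/eqP.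
have lA a : linear (resA act a) by exact: actr.
apply: (eigen_ker (chi' := chi)) => [a|].
  rewrite addrC -scaleNr lA chiE (data_chi d).
  by rewrite scalerDr !scalerA [chi a * _]mulrC.
rewrite -scaleN1r addrC (data_lin d) (linearZP _ (data_lin d)) (data_pi d).
by rewrite -[_ *: 1]/(_ * 1) mulr1 scaleN1r addNr.
Qed.

(** Since [m] generates over [U], the functional [pi'] is determined by [rho'] and the scalar
    [pi' m], which cannot vanish. Once [rho' = rho], both functionals are therefore proportional. *)
Lemma codim1_uniq (pi' : M -> k) (rho' : Alg U) : linear (pi' : M -> k^o) ->
  (exists v, pi' v <> 0) -> (forall u v, pi' (resU act u v) = rho' u * pi' v) ->
  rho' = rho /\ forall v, pi' v = 0 <-> pi v = 0.
Proof.
move=> lpi' [v0 pv0] rhoE.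
have piE u : pi' (act (u \ox 1) m) = rho' u * pi' m := rhoE u m.
have pm0 : pi' m != 0.
  apply/eqP => pm; apply: pv0; have [u ->] := data_gen d v0.
  by rewrite piE pm mulr0.
have rr : rho' = rho.
  apply: detU => g gg; apply: (mulIf pm0); rewrite -piE.
  rewrite [act _ m](eigen_line (m' := act (g \ox 1) m)) => [|a].
    by rewrite (linearZP _ lpi') data_pi_act.
  rewrite /resA (Uact_eigen (data_chi d)) Uact_tens_chi mul1r.
  by rewrite chi_act_grouplike // tensZl (linearZP _ (actl _)).
split=> // v; have [u ->] := data_gen d v; rewrite piE data_pi_act rr.
split=> [/eqP|->]; last by rewrite mul0r.
by rewrite mulf_eq0 (negPf pm0) orbF => /eqP.
Qed.

End Uniqueness.

Lemma HM_unique : in_HM tau tauV act ->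
  (exists! P : set M, is_submodule (resA act) P /\ dim1 P) /\
  (exists! N : set M, is_submodule (resU act) N /\ codim1 N).
Proof.
move=> /in_HM_data[m [chi [pi [rho d]]]].
have m0 : m <> 0.
  by move=> m0; have/eqP := data_pi d; rewrite m0 (linear0P (data_lin d)) eq_sym oner_eq0.
split.
  exists (line m); split.
    by split; [exact: (char_line resA_module (data_chi d)) | exists m].
  move=> P [subP [m' m'0 PE]]; rewrite {}PE in subP *.
  have [chi' chiE] := line_char resA_module m'0 subP.
  have chi_eq := eigen_char d m'0 chiE; rewrite chi_eq in chiE.
  have m'E := eigen_line d chiE.
  have pm' : pi m' != 0 by apply/eqP => p0; apply: m'0; rewrite m'E p0 scale0r.
  rewrite m'E predeqE => x; split=> [[c ->]|[c ->]]; last first.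
    by exists (c * pi m'); rewrite scalerA.
  by exists (c / pi m'); rewrite scalerA mulfVK.
exists [set x | pi x = 0]; split.
  exact: char_codim1 (data_lin d) (data_pi d) (data_rho d).
move=> N [subN codN].
have [pi' [rho' [lpi' [v pv] NE rhoE]]] := codim1_char resU_module subN codN.
have [|_ piE] := codim1_uniq d lpi' _ rhoE.
  by exists v; rewrite pv; apply/eqP/oner_neq0.
by rewrite predeqE => x; rewrite /= -piE -NE.
Qed.

End OneModule.
End TwistedModules.

(** * The modules [L(rho, chi)] *)

Section ModuleIso.
Variables (k : fieldType) (B : lmodType k).

Lemma linear_exists (M M' : lmodType k) (f : M -> M') : linear f ->
  exists g : {linear M -> M'}, g =1 f.
Proof.
move=> lf; pose lf' := GRing.isLinear.Build k M M' *:%R f lf.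
pose g : {linear M -> M'} := HB.pack f lf'.
by exists g.
Qed.

Lemma inj_surj_bij (T T' : Type) (f : T -> T') :
  injective f -> (forall y, exists x, f x = y) -> bijective f.
Proof.
move=> f_inj f_surj; pose g y := projT1 (cid (f_surj y)).
have fK y : f (g y) = y by rewrite /g; case: cid.
by exists g => // x; apply: f_inj; rewrite fK.
Qed.

Variables (M M' M'' : lmodType k) (act : B -> M -> M) (act' : B -> M' -> M')
  (act'' : B -> M'' -> M'').

Lemma module_isoP (f : M -> M') : linear f -> injective f ->
  (forall y, exists x, f x = y) -> (forall b m, f (act b m) = act' b (f m)) ->
  module_iso act act'.
Proof.
move=> lf f_inj f_surj fact; have [g gE] := linear_exists lf.
have {}gE : GRing.Linear.sort g = f by apply/funext.
by exists g; rewrite gE //; apply: inj_surj_bij.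
Qed.

Lemma module_iso_refl : module_iso act act.
Proof. by exists idfun => //; exists idfun. Qed.

Lemma module_iso_sym : module_iso act act' -> module_iso act' act.
Proof.
move=> [f [g gK fK] fact].
have lg : linear g.
  by move=> c x y; apply: (can_inj gK); rewrite linearP !fK.
have [h hE] := linear_exists lg.
have {}hE : GRing.Linear.sort h = g by apply/funext.
exists h; rewrite hE; first by exists f.
by move=> b m; apply: (can_inj gK); rewrite fact !fK.
Qed.

Lemma module_iso_trans :
  module_iso act act' -> module_iso act' act'' -> module_iso act act''.
Proof.
move=> [f bf fact] [g bg gact].
exists (g \o f)%FUN; first exact: bij_comp.
by move=> b m /=; rewrite fact gact.
Qed.

End ModuleIso.

Section SimpleQuotient.
Variables (k : fieldType) (U A : bialgType k) (tau tauV : {scalar tensor U A}).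
Hypotheses (tauP : skew_pairing tau)
  (tauVP : conv_inverse (C := tensor U A) tau tauV).
Local Notation H := (tensor U A).
Local Notation Hmul := (twist_mul tau tauV).
Variables (rho : Alg U) (chi : Alg A).
Local Notation Iset := (Iset tau tauV rho chi).
Local Notation Uact := (Uact tau tauV chi).
Local Notation L := (L tau tauV rho chi).
Local Notation Lact := (@Lact k U A tau tauV rho chi).
Local Notation cl := (quotmod_pi (Iset_subspace tau tauV rho chi)).

Lemma Iset_ker u : Iset u -> rho u = 0.
Proof.
move=> [s Hs ->]; rewrite linear_sum big_seq big1 // => y /Hs[N [_ N0] Ny].
exact: N0.
Qed.

Lemma Iset_max N : is_submodule Uact N -> (forall u, N u -> rho u = 0) ->
  forall u, N u -> Iset u.
Proof.
move=> subN N0 u Nu; exists [:: u]; last by rewrite big_seq1.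
by move=> y; rewrite inE => /eqP ->; exists N.
Qed.

Lemma Iset_submodule : is_submodule Uact Iset.
Proof.
have [I0 ID IZ] := Iset_subspace tau tauV rho chi.
by split=> // h u; apply: Iset_act.
Qed.

Lemma rho_repr u : rho (repr (cl u)) = rho u.
Proof.
apply/eqP; rewrite -subr_eq0 -linearB; apply/eqP/Iset_ker.
exact/(quotmod_piP (Iset_subspace tau tauV rho chi))/quotmod_piK.
Qed.

Lemma L_module : is_module Hmul (twist_one U A) Lact.
Proof.
have UP := Uact_module tauP tauVP chi.
split=> [q|h c q r|q|h h' q].
- apply: (linear_compl (f := cl) (g := fun h => Uact h (repr q))).
    exact: quotmod_pi_linear.
  exact: (act_linearl UP).
- rewrite -(quotmod_piK q) -(quotmod_piK r) -quotmod_pi_linear !Lact_pi.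
  by rewrite (act_linearr UP) quotmod_pi_linear.
- by rewrite -(quotmod_piK q) Lact_pi (act_one UP).
- by rewrite -(quotmod_piK q) !Lact_pi (act_mul UP).
Qed.

Lemma Uact_resU u v : Uact (u \ox 1) v = u * v.
Proof. by rewrite Uact_tens_chi (chi_act1 tauP tauVP). Qed.

(** [rho] descends to the quotient because it vanishes on [Iset]. A submodule killed by the
    descended functional has as preimage a submodule of [U_chi] inside the kernel of [rho], hence
    inside [Iset] by maximality. *)
Lemma L_data : HM_data Lact (cl 1) chi (fun q => rho (repr q)) rho.
Proof.
have lr := lin_Alg rho.
split=> [a|q||||P subP P0 q].
- rewrite /resA Lact_pi Uact_tens_chi mul1r (chi_act_1r tauP tauVP).
  exact: (linearZP _ (quotmod_pi_linear _)).
- exists (repr q).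
  by rewrite Lact_pi Uact_resU mulr1 quotmod_piK.
- move=> c q r; rewrite -{1}(quotmod_piK q) -{1}(quotmod_piK r).
  by rewrite -quotmod_pi_linear rho_repr lr.
- by rewrite rho_repr rmorph1.
- move=> u q; rewrite -{1}(quotmod_piK q) /resU Lact_pi rho_repr Uact_resU.
  by rewrite rmorphM.
- rewrite -(quotmod_piK q) => Pq.
  have /(quotmod_piP (Iset_subspace tau tauV rho chi)) -> : Iset (repr q - 0).
    rewrite subr0; apply: (@Iset_max (fun u => P (cl u))) => //.
      split=> [|x y Px Py|c x Px|h x Px].
      + rewrite (linear0P (quotmod_pi_linear _)); exact: (submod0 subP).
      + by rewrite quotmod_piD; apply: (submodD subP).
      + rewrite (linearZP _ (quotmod_pi_linear _)); exact: (submodZ subP).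
      + by rewrite -Lact_pi; apply: (submod_act subP).
    by move=> u /P0; rewrite rho_repr.
  exact: (linear0P (quotmod_pi_linear _)).
Qed.

(** The map [phi] is a surjection from [U_chi] with [pi] pulling back to [rho]. Its kernel is a
    submodule inside the kernel of [rho], hence lies in [Iset]; conversely the image of [Iset] is a
    submodule killed by [pi], hence zero. *)
Lemma L_iso (M : lmodType k) (act : H -> M -> M) m pi :
  is_module Hmul (twist_one U A) act -> HM_data act m chi pi rho ->
  module_iso Lact act.
Proof.
move=> actP d; pose phi u := act (u \ox 1) m.
have lphi : linear phi.
  have actl := act_linearl actP; rewrite /phi; lin.
have phiE h u : act h (phi u) = phi (Uact h u).
  exact: (Uact_eigen tauP tauVP actP (data_chi d)).
have pi_phi u : pi (phi u) = rho u := data_pi_act d u.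
have phi0 u : phi u = 0 <-> Iset u.
  split=> [u0|Iu].
    apply: (@Iset_max [set v | phi v = 0]) => //=.
      split=> [|x y /= x0 y0|c x /= x0|h x /= x0].
      + exact: (linear0P lphi).
      + by rewrite (linearDP lphi) x0 y0 addr0.
      + by rewrite (linearZP _ lphi) x0 scaler0.
      + by rewrite -phiE x0 (linear0P (act_linearr actP h)).
    by move=> v v0; rewrite -pi_phi v0 (linear0P (data_lin d)).
  apply: (data_cog d (P := [set v | exists2 w, Iset w & v = phi w])).
  - have [I0 ID IZ Iact] := Iset_submodule.
    split=> [|x y [w Iw ->] [w' Iw' ->]|c x [w Iw ->]|h x [w Iw ->]].
    + by exists 0; rewrite ?(linear0P lphi).
    + by exists (w + w'); [exact: ID | rewrite (linearDP lphi)].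
    + by exists (c *: w); [exact: IZ | rewrite (linearZP _ lphi)].
    + by exists (Uact h w); [exact: Iact | rewrite phiE].
  - by move=> x [w Iw ->]; rewrite pi_phi Iset_ker.
  - by exists u.
have phi_cl u : phi (repr (cl u)) = phi u.
  apply/eqP; rewrite -subr_eq0 -scaleN1r addrC -lphi scaleN1r addrC.
  apply/eqP/phi0.
  exact/(quotmod_piP (Iset_subspace tau tauV rho chi))/quotmod_piK.
apply: (module_isoP (f := fun q : L => phi (repr q))).
- move=> c q r; rewrite -{1}(quotmod_piK q) -{1}(quotmod_piK r).
  by rewrite -quotmod_pi_linear phi_cl lphi.
- move=> q r qr; rewrite -(quotmod_piK q) -(quotmod_piK r).
  apply/(quotmod_piP (Iset_subspace tau tauV rho chi))/phi0.
  by rewrite -scaleN1r addrC lphi qr scaleN1r addNr.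
- by move=> v; have [u ->] := data_gen d v; exists (cl u); rewrite phi_cl.
- by move=> h q; rewrite -{1}(quotmod_piK q) Lact_pi phi_cl phiE.
Qed.

End SimpleQuotient.

(** * Isomorphism classes and pairs of characters *)

Section Classification.
Variables (k : fieldType) (U A : bialgType k) (tau tauV : {scalar tensor U A}).
Hypotheses (tauP : skew_pairing tau)
  (tauVP : conv_inverse (C := tensor U A) tau tauV).
Hypotheses (detU : determined_by_grouplikes U)
  (detA : determined_by_grouplikes A).

Lemma L_in_HM (rho : Alg U) (chi : Alg A) :
  in_HM tau tauV (@Lact k U A tau tauV rho chi).
Proof.
exact: (data_in_HM tauP tauVP (L_module tauP tauVP rho chi)
  (L_data tauP tauVP rho chi)).
Qed.

(** The isomorphism pushes the eigenvector [m] forward to [M'] and pulls [pi'] back to [M];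
    uniqueness of the characters inside a single module then applies on each side. *)
Lemma data_iso_eq (M M' : lmodType k) (act : tensor U A -> M -> M)
    (act' : tensor U A -> M' -> M') m chi pi rho m' chi' pi' rho' :
  is_module (twist_mul tau tauV) (twist_one U A) act ->
  is_module (twist_mul tau tauV) (twist_one U A) act' ->
  HM_data act m chi pi rho -> HM_data act' m' chi' pi' rho' ->
  module_iso act act' -> rho = rho' /\ chi = chi'.
Proof.
move=> actP actP' d d' [f bf fact].
have m0 : m <> 0.
  by move=> m0; have/eqP := data_pi d; rewrite m0 (linear0P (data_lin d)) eq_sym oner_eq0.
split.
  have lpf : linear (fun v => pi' (f v) : k^o).
    exact: (linear_compl (data_lin d') (lin_morph f)).
  have [||-> _] := codim1_uniq tauP tauVP actP detU detA d lpf (rho' := rho').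
  - have [g _ gK] := bf; exists (g m'); rewrite gK (data_pi d').
    exact/eqP/oner_neq0.
  - by move=> u v; rewrite /resU fact (data_rho d').
  - by [].
apply: (eigen_char tauP tauVP actP' detU detA d' (m' := f m)).
  by move=> fm0; apply: m0; apply: (bij_inj bf); rewrite fm0 linear0.
by move=> a; rewrite /resA -fact -[act _ _]/(resA act a m) (data_chi d) linearZ.
Qed.

Lemma HM_class_eq (X Y : HM_obj tau tauV) :
  HM_class X = HM_class Y <-> module_iso (@HM_act _ _ _ _ _ X) (@HM_act _ _ _ _ _ Y).
Proof.
split=> [/(congr1 (@proj1_sig _ _)) /= XY|XY].
  rewrite -[module_iso _ _]/(HM_class_of X Y) XY; exact: module_iso_refl.
apply: eq_exist; apply/funext => Z; apply/propext; split.
  exact/module_iso_trans/module_iso_sym.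
exact: module_iso_trans.
Qed.

Lemma L_class_bij : bijective (fun p : Alg U * Alg A =>
  HM_class (HMObj (L_in_HM p.1 p.2))).
Proof.
apply: inj_surj_bij => [[rho chi] [rho' chi'] /HM_class_eq /= iso|[C [X CX]]].
  by have [-> ->] := data_iso_eq (L_module tauP tauVP rho chi)
    (L_module tauP tauVP rho' chi') (L_data tauP tauVP rho chi)
    (L_data tauP tauVP rho' chi') iso.
have [m [chi [pi [rho d]]]] := in_HM_data tauP tauVP (HM_module (HM_prop X)) (HM_prop X).
exists (rho, chi).
have -> : exist _ C (ex_intro _ X CX) = HM_class X by apply: eq_exist.
apply/HM_class_eq.
exact: (L_iso tauP tauVP (HM_module (HM_prop X)) d).
Qed.

End Classification.

(** * Finite-dimensional modules *)

Section FiniteDimension.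
Variables (k : fieldType).

(** Take a matrix of maximal rank among those with row space inside [P]: adjoining a vector of [P]
    outside the row space would raise the rank. *)
Lemma subspace_mx n (P : set 'rV[k]_n) : is_subspace P ->
  exists V : 'M[k]_n, forall x, P x <-> (x <= V)%MS.
Proof.
move=> [P0 PD PZ].
pose Q d := `[< exists2 V : 'M[k]_n, \rank V = d &
                forall x : 'rV_n, (x <= V)%MS -> P x >].
have Q0 : Q 0%N.
  apply/asboolP; exists 0; first exact: mxrank0.
  by move=> x; rewrite submx0 => /eqP ->.
have Qn d : Q d -> (d <= n)%N by move=> /asboolP[V <- _]; apply: rank_leq_row.
have [d /asboolP[V rV VP] d_max] := ex_maxnP (ex_intro Q _ Q0) Qn.
exists V => x; split=> [Px|/VP//]; apply: contrapT => /negP xV.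
have ltV : (V < V + x)%MS.
  by rewrite ltmxE addsmxSl /=; apply: contra xV; apply: submx_trans (addsmxSr _ _).
have /d_max : Q (\rank (V + x)%MS).
  apply/asboolP; exists (V + x)%MS => // y /sub_addsmxP[[u1 u2] /= ->].
  apply: PD; first by apply: VP; apply: submxMl.
  by rewrite [u2]mx11_scalar mul_scalar_mx; apply: PZ.
by rewrite leqNgt -rV rank_ltmx.
Qed.

Variables (M : lmodType k) (n : nat).
Hypothesis dimM : has_dim M n.

Lemma dim_iso : exists (f : M -> 'rV[k]_n) (g : 'rV[k]_n -> M),
  [/\ linear f, linear g, cancel f g & cancel g f].
Proof.
have [f [g gK fK]] := dimM; exists f, g; split=> //; first exact: linearP.
by move=> c x y; apply: (can_inj gK); rewrite linearP !fK.
Qed.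

Variable P : set M.
Hypothesis subP : is_subspace P.

(** A row basis gives the inclusion [i] and its pseudo-inverse the retraction [p]. Coordinates turn
    the subset [P] into a carrier type on which an induction on dimension can continue. *)
Lemma subspace_param : exists m (i : 'rV[k]_m -> M) (p : M -> 'rV[k]_m),
  [/\ linear i, linear p, cancel i p, forall x, P x <-> i (p x) = x &
      P <> setT -> (m < n)%N].
Proof.
have [f [g [lf lg fK gK]]] := dim_iso; have [P0 PD PZ] := subP.
have [|V VP] := @subspace_mx n (fun y => P (g y)).
  split=> [|x y|c x]; first by rewrite (linear0P lg).
  - by rewrite (linearDP lg); apply: PD.
  - by rewrite (linearZP _ lg); apply: PZ.
pose b := row_base V.
exists (\rank V), (fun y => g (y *m b)), (fun x => f x *m pinvmx b); split.
- by move=> c x y; rewrite mulmxDl -scalemxAl lg.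
- by move=> c x y; rewrite lf mulmxDl -scalemxAl.
- by move=> y; rewrite gK -mulmxA mulmxVp ?mulmx1 // row_base_free.
- move=> x; rewrite -{1}(fK x); split=> [/VP xV|xE].
    by rewrite mulmxKpV ?fK // eq_row_base.
  by apply/VP; rewrite -(gK (f x)) fK -xE gK -(eq_row_base V) submxMl.
move=> PT; rewrite ltn_neqAle rank_leq_row andbT; apply/eqP => rV.
apply: PT; rewrite predeqE => x; split=> // _; rewrite -(fK x).
by apply/VP; rewrite submx_full // /row_full rV.
Qed.

(** The dual of [subspace_param]: the columns of a cokernel matrix give the projection [q], and a
    pseudo-inverse gives the section [s]. *)
Lemma subspace_quot : exists r (q : M -> 'rV[k]_r) (s : 'rV[k]_r -> M),
  [/\ linear q, linear s, cancel s q, forall x, P x <-> q x = 0 &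
      P <> [set 0] -> (r < n)%N].
Proof.
have [f [g [lf lg fK gK]]] := dim_iso; have [P0 PD PZ] := subP.
have [|V VP] := @subspace_mx n (fun y => P (g y)).
  split=> [|x y|c x]; first by rewrite (linear0P lg).
  - by rewrite (linearDP lg); apply: PD.
  - by rewrite (linearZP _ lg); apply: PZ.
pose C := col_base (cokermx V).
exists (\rank (cokermx V)), (fun x => f x *m C), (fun y => g (y *m pinvmx C)).
split.
- by move=> c x y; rewrite lf mulmxDl -scalemxAl.
- by move=> c x y; rewrite mulmxDl -scalemxAl lg.
- by move=> y; rewrite gK -mulmxA mulVpmx ?mulmx1 // col_base_full.
- move=> x; rewrite -{1}(fK x) VP submxE -{1}(mulmx_base (cokermx V)) mulmxA.
  split=> [/eqP E|->]; last by rewrite mul0mx.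
  by apply: (row_free_inj (row_base_free (cokermx V))); rewrite E mul0mx.
move=> P1; rewrite mxrank_coker -subn_gt0 subKn ?rank_leq_row //.
rewrite lt0n mxrank_eq0; apply/eqP => V0; apply: P1; rewrite predeqE => x.
split=> [Px|->] //=; rewrite -(fK x) in Px *; move/VP: Px.
by rewrite V0 submx0 => /eqP ->; rewrite (linear0P lg).
Qed.

End FiniteDimension.

Lemma has_dim_rV (k : fieldType) n : has_dim 'rV[k]_n n.
Proof. by exists idfun; exists idfun. Qed.

Lemma dim1_line (k : fieldType) (M : lmodType k) (m : M) :
  has_dim M 1 -> m <> 0 -> line m = setT.
Proof.
move=> [f bf] m0; rewrite predeqE => x; split=> // _.
have fm0 : f m 0 0 != 0.
  apply/eqP => fm0; apply: m0; apply: (bij_inj bf); rewrite linear0.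
  by apply/rowP => j; rewrite ord1 fm0 mxE.
exists (f x 0 0 / f m 0 0); apply: (bij_inj bf); apply/rowP => j.
by rewrite linearZ mxE ord1 divfK.
Qed.

Section ModuleTransport.
Variables (k : fieldType) (B : lmodType k) (mulB : B -> B -> B) (oneB : B).
Variables (M M' : lmodType k) (act : B -> M -> M).
Hypothesis actP : is_module mulB oneB act.
Let actl := act_linearl actP.
Let actr := act_linearr actP.

Lemma submodule_subspace (P : set M) : is_submodule act P -> is_subspace P.
Proof. by case. Qed.

Lemma line_submodule (m : M) : is_submodule act (line m) <->
  forall b, exists c : k, act b m = c *: m.
Proof.
split=> [lm b|lm]; first by apply: (submod_act lm); exists 1; rewrite scale1r.
split=> [|x y [c ->] [d ->]|c x [d ->]|b x [d ->]].
- by exists 0; rewrite scale0r.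
- by exists (c + d); rewrite scalerDl.
- by exists (c * d); rewrite scalerA.
- have [c cE] := lm b; exists (d * c).
  by rewrite (linearZP _ (actr b)) cE scalerA.
Qed.

Lemma submodule_transport (P : set M) (i : M' -> M) (p : M -> M') :
  is_submodule act P -> linear i -> linear p -> cancel i p ->
  (forall x, P x <-> i (p x) = x) ->
  is_module mulB oneB (fun b y => p (act b (i y))) /\
  forall b y, i (p (act b (i y))) = act b (i y).
Proof.
move=> subP li lp iK PE.
have iE b y : i (p (act b (i y))) = act b (i y).
  by apply/PE; apply: (submod_act subP); apply/PE; rewrite iK.
split=> //; split=> [y|b|y|b c y].
- by lin.
- by lin.
- by rewrite (act_one actP) iK.
- by rewrite iE (act_mul actP).
Qed.

Lemma quotient_transport (P : set M) (q : M -> M') (s : M' -> M) :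
  is_submodule act P -> linear q -> linear s -> cancel s q ->
  (forall x, P x <-> q x = 0) ->
  is_module mulB oneB (fun b y => q (act b (s y))) /\
  forall b x, q (act b (s (q x))) = q (act b x).
Proof.
move=> subP lq ls sK PE.
(* The section [s] is only linear, but [s (q x)] and [x] differ by an element of the stable subspace
   [P]. *)
have qE b x : q (act b (s (q x))) = q (act b x).
  apply/eqP; rewrite -subr_eq0 -scaleN1r addrC -lq -(linearZP _ (actr b)).
  rewrite -(linearDP (actr b)); apply/eqP/PE/(submod_act subP)/PE.
  by rewrite lq sK scaleN1r addNr.
split=> //; split=> [y|b|y|b c y].
- by lin.
- by lin.
- by rewrite (act_one actP) sK.
- by rewrite qE (act_mul actP).
Qed.

Lemma not_irreducible : (exists m : M, m <> 0) -> ~ irreducible act ->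
  exists P, [/\ is_submodule act P, P <> [set 0] & P <> setT].
Proof.
move=> nzM nirr; apply: contrapT => nP; apply: nirr; split=> // N subN.
have [->|N0] := pselect (N = [set 0]); first by left.
by right; apply: contrapT => NT; apply: nP; exists N.
Qed.

End ModuleTransport.

Section OneDimensional.
Variables (k : fieldType) (B : bialgType k).
Hypothesis irr1 : forall (M : lmodType k) (act : B -> M -> M),
  is_module *%R 1 act -> finite_dim M -> irreducible act -> has_dim M 1.

Lemma submodule_nonzero (M : lmodType k) (act : B -> M -> M) (P : set M) :
  is_submodule act P -> P <> [set 0] -> exists2 x, P x & x <> 0.
Proof.
move=> subP P0; apply: contrapT => nx; apply: P0; rewrite predeqE => x.
split=> [Px|->]; last exact: (submod0 subP).
by apply: contrapT => x0; apply: nx; exists x.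
Qed.

(** Descent to a proper nonzero submodule, as long as there is one; an irreducible module is itself
    a line by [irr1]. *)
Lemma exists_line (n : nat) (M : lmodType k) (act : B -> M -> M) :
  is_module *%R 1 act -> has_dim M n -> (exists m : M, m <> 0) ->
  exists2 m : M, m <> 0 & is_submodule act (line m).
Proof.
elim/ltn_ind: n M act => n IH M act actP dimM nzM.
have [irr|/(not_irreducible nzM)[P [subP P0 PT]]] := pselect (irreducible act).
  have [m m0] := nzM; exists m => //.
  by rewrite dim1_line //; apply: (irr1 actP _ irr); exists n.
have [m [i [p [li lp iK PE ltm]]]] :=
  subspace_param dimM (submodule_subspace subP).
have [actP' iE] := submodule_transport actP subP li lp iK PE.
have [||y y0 /(line_submodule actP') ly] := IH m (ltm PT) _ _ actP'.
- exact: has_dim_rV.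
- have [x Px x0] := submodule_nonzero subP P0; exists (p x) => px0.
  by apply: x0; rewrite -((PE x).1 Px) px0 (linear0P li).
exists (i y); first by move=> iy0; apply: y0; rewrite -(iK y) iy0 (linear0P lp).
apply/(line_submodule actP) => b; have [c cE] := ly b.
by exists c; rewrite -iE cE (linearZP _ li).
Qed.

(** The dual descent, through quotients: a hyperplane of the quotient is pulled back along [q], and
    in an irreducible module the hyperplane is zero. *)
Lemma exists_codim1 (n : nat) (M : lmodType k) (act : B -> M -> M) :
  is_module *%R 1 act -> has_dim M n -> (exists m : M, m <> 0) ->
  exists2 N : set M, is_submodule act N & codim1 N.
Proof.
elim/ltn_ind: n M act => n IH M act actP dimM nzM.
have [irr|/(not_irreducible nzM)[P [subP P0 PT]]] := pselect (irreducible act).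
  have [m m0] := nzM; exists [set 0].
    split=> [|x y /= -> ->|c x /= ->|b x /= ->] //=; first by rewrite addr0.
      by rewrite scaler0.
    exact: (linear0P (act_linearr actP b)).
  exists m => // x; have : line m x.
    by rewrite dim1_line //; apply: (irr1 actP _ irr); exists n.
  by move=> [c ->]; exists c; rewrite /= subrr.
have [r [q [s [lq ls sK PE ltr]]]] :=
  subspace_quot dimM (submodule_subspace subP).
have [actP' qE] := quotient_transport actP subP lq ls sK PE.
have [||N subN [y Ny Ncod]] := IH r (ltr P0) _ _ actP'.
- exact: has_dim_rV.
- apply: contrapT => nx; apply: PT; rewrite predeqE => x; split=> // _.
  by apply/PE; apply: contrapT => qx0; apply: nx; exists (q x).
exists [set x | N (q x)].
  split=> [|x x' /= Nx Nx'|c x /= Nx|b x /= Nx].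
  - by rewrite /= (linear0P lq); apply: (submod0 subN).
  - by rewrite (linearDP lq); apply: (submodD subN).
  - by rewrite (linearZP _ lq); apply: (submodZ subN).
  - by rewrite -qE; apply: (submod_act subN b).
exists (s y); first by rewrite /= sK.
move=> x; have [c Nc] := Ncod (q x); exists c => /=.
by rewrite -scaleNr addrC lq sK scaleNr addrC.
Qed.

End OneDimensional.

(** * Finite-dimensional irreducible modules of [H] *)

Section FiniteDimensionalSimple.
Variables (k : fieldType) (U A : bialgType k) (tau tauV : {scalar tensor U A}).
Hypotheses (tauP : skew_pairing tau)
  (tauVP : conv_inverse (C := tensor U A) tau tauV).
Hypotheses (detU : determined_by_grouplikes U)
  (detA : determined_by_grouplikes A).
Variables (M : lmodType k) (act : tensor U A -> M -> M).

(** Irreducibility over [H] makes any nonzero vector a generator and leaves no nonzero submodule in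
    a proper subspace. It remains to find the line over [A] and the hyperplane over [U]. *)
Lemma irreducible_in_HM :
  (forall (N : lmodType k) (actU : U -> N -> N), is_module *%R 1 actU ->
     finite_dim N -> irreducible actU -> has_dim N 1) ->
  (forall (N : lmodType k) (actA : A -> N -> N), is_module *%R 1 actA ->
     finite_dim N -> irreducible actA -> has_dim N 1) ->
  is_module (twist_mul tau tauV) (twist_one U A) act ->
  finite_dim M -> irreducible act -> in_HM tau tauV act.
Proof.
move=> irrU irrA actP [n dimM] [nzM irr]; split=> //.
  have [m m0 lm] := exists_line irrA (resA_module tauP tauVP actP) dimM nzM.
  exists m; split=> // N subN Nm; case: (irr N subN) => // N0.
  by move: Nm; rewrite N0 /= => /m0.
have [N subN codN] := exists_codim1 irrU (resU_module tauP tauVP actP) dimM nzM.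
exists N; split=> // P subP PN; case: (irr P subP) => // PT.
by have [m Nm _] := codN; case: Nm; apply: PN; rewrite PT.
Qed.

(** A nonzero [H]-submodule, restricted to [A], contains an eigenvector by [exists_line]. That
    eigenvector is a multiple of the generator [m], so the submodule is everything. *)
Lemma in_HM_irreducible :
  (forall (N : lmodType k) (actA : A -> N -> N), is_module *%R 1 actA ->
     finite_dim N -> irreducible actA -> has_dim N 1) ->
  in_HM tau tauV act -> finite_dim M -> irreducible act.
Proof.
move=> irrA HM [n dimM]; have actP := HM_module HM.
have [m [chi [pi [rho d]]]] := in_HM_data tauP tauVP actP HM.
have actPA := resA_module tauP tauVP actP.
split.
  exists m => m0; have/eqP := data_pi d.
  by rewrite m0 (linear0P (data_lin d)) eq_sym oner_eq0.
move=> N subN; have [->|N0] := pselect (N = [set 0]); first by left.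
right.
have subNA : is_submodule (resA act) N.
  by have [? ? ? NA] := subN; split=> // a x; apply: NA.
have [r [i [p [li lp iK NE _]]]] :=
  subspace_param dimM (submodule_subspace subN).
have [actP' iE] := submodule_transport actPA subNA li lp iK NE.
have [|y y0 ly] := exists_line irrA actP' (has_dim_rV k r).
  have [x Nx x0] := submodule_nonzero subNA N0; exists (p x) => px0.
  by apply: x0; rewrite -((NE x).1 Nx) px0 (linear0P li).
have iy0 : i y <> 0 by move=> iy0; apply: y0; rewrite -(iK y) iy0 (linear0P lp).
have [chi' chiE'] := line_char actP' y0 ly.
have chiE a : resA act a (i y) = chi' a *: i y.
  by rewrite -iE chiE' (linearZP _ li).
have E := eigen_char tauP tauVP actP detU detA d iy0 chiE.
rewrite E in chiE; have iyE := eigen_line tauP tauVP actP d chiE.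
have pi0 : pi (i y) != 0 by apply/eqP => p0; apply: iy0; rewrite iyE p0 scale0r.
have Nm : N m.
  have -> : m = (pi (i y))^-1 *: i y by rewrite {2}iyE scalerA mulVf ?scale1r.
  by apply: (submodZ subN); apply/NE; rewrite iK.
rewrite predeqE => v; split=> // _; have [u ->] := data_gen d v.
exact: (submod_act subN).
Qed.

End FiniteDimensionalSimple.

Theorem theorem4p1 (k : fieldType) (U A : bialgType k)
    (tau tauV : {scalar tensor U A})
    (tau_skew : skew_pairing tau)
    (tau_inv : conv_inverse (C := tensor U A) tau tauV)
    (detU : determined_by_grouplikes U)
    (detA : determined_by_grouplikes A) :
  (* Alg(U, k) and Alg(A, k) are abelian *)
  [/\ comm_monoid_law (@alg_mul k U) (alg_counit U),
      comm_monoid_law (@alg_mul k A) (alg_counit A),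
      has_antipode U -> abelian_group_law (@alg_mul k U) (alg_counit U) &
      has_antipode A -> abelian_group_law (@alg_mul k A) (alg_counit A)] /\
  (* a *)
  (exists L_in_HM : forall (rho : Alg U) (chi : Alg A),
       in_HM tau tauV (@Lact k U A tau tauV rho chi),
     bijective (fun p : Alg U * Alg A => HM_class (HMObj (L_in_HM p.1 p.2)))) /\
  (* b *)
  (forall (M : lmodType k) (act : tensor U A -> M -> M), in_HM tau tauV act ->
     (exists! P : set M, is_submodule (resA act) P /\ dim1 P) /\
     (exists! N : set M, is_submodule (resU act) N /\ codim1 N)) /\
  (* c *)
  ((forall (M : lmodType k) (act : U -> M -> M), is_module *%R 1 act ->
      finite_dim M -> irreducible act -> has_dim M 1) ->
   (forall (M : lmodType k) (act : A -> M -> M), is_module *%R 1 act ->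
      finite_dim M -> irreducible act -> has_dim M 1) ->
   forall (M : lmodType k) (act : tensor U A -> M -> M),
     (is_module (twist_mul tau tauV) (twist_one U A) act /\
      finite_dim M /\ irreducible act) <->
     (in_HM tau tauV act /\ finite_dim M)).
Proof.
split.
  by split; [exact: alg_mul_law | exact: alg_mul_law
            | exact: alg_mul_group | exact: alg_mul_group].
split; first by exists (L_in_HM tau_skew tau_inv); exact: L_class_bij.
split=> [M act HM|irrU irrA M act].
  exact: HM_unique tau_skew tau_inv M act (HM_module HM) detU detA HM.
split=> [[actP [fdM irr]]|[HM fdM]].
  by split=> //; apply: irreducible_in_HM irrU irrA actP fdM irr.
by split; [exact: HM_module HM | split=> //; apply: in_HM_irreducible irrA HM fdM].
Qed.
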